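(* Consider the repeated newsvendor with horizon $T$, actions $X_t\in[0,B]$, demands $D_t\in[0,B]$ almost surely, and observations $O_t=\psi(X_t,D_t)=(\min\{D_t,X_t\},\mathbf{1}\{D_t\le X_t\})$; $H_t=((X_s,O_s))_{s\le t}$. Let $\mathbb{P}^\star$ be the true environment, $\pi_\theta$ a deployed policy, and $\mathbb{P}^\star_{\pi_\theta}$ the induced interaction law. For each $t$ and history $h$, let $Q_t^\star(\cdot\mid h)$ be the true law of $D_{1:T}$ given $H_{t-1}=h$ and $Q_{t,\theta}(\cdot\mid h)$ a learned law on $[0,B]^T$; let $q_t^\star(\cdot\mid h)$ and $q_{t,\theta}(\cdot\mid h)$ be the corresponding laws of the time-$t$ coordinate. Assume both $Q_t^\star(\cdot\mid h)$ and $Q_{t,\theta}(\cdot\mid h)$ are given by autoregressive factorizations over the $T$ coordinates in a common generation order whose first generated coordinate is the time-$t$ demand: $Q^\star_t(d\tilde d_{1:T}\mid h)=q^\star_{t,1}(d\tilde d_1\mid h)\prod_{s=2}^T q^\star_{t,s}(d\tilde d_s\mid h,\tilde d_{1:s-1})$ and likewise for $Q_{t,\theta}$ with kernels $q_{t,s,\theta}$, so that $q^\star_{t,1}=q^\star_t$ and $q_{t,1,\theta}=q_{t,\theta}$. Define $d(h)=\mathrm{KL}(q^\star_{t,1}(\cdot\mid h)\|q_{t,1,\theta}(\cdot\mid h))$ and, for $s\ge2$, $\delta_s(h)=\mathbb{E}_{\tilde D_{1:s-1}\sim Q_t^\star(\cdot\mid h)}[\mathrm{KL}(q^\star_{t,s}(\cdot\mid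 h,\tilde D_{1:s-1})\|q_{t,s,\theta}(\cdot\mid h,\tilde D_{1:s-1}))]$. For $x\in[0,B]$ let $P^{\mathrm{obs}}_{h,x}$ and $Q^{\mathrm{obs}}_{h,x}$ be the pushforwards of $q_t^\star(\cdot\mid h)$ and $q_{t,\theta}(\cdot\mid h)$ under $d\mapsto\psi(x,d)$. Define $$\Delta_T^{\mathrm{comp}}(\theta;\pi_\theta)=\sum_{t=1}^T\mathbb{E}_{H_{t-1}\sim\mathbb{P}^\star_{\pi_\theta}}\big[\mathrm{KL}(Q_t^\star(\cdot\mid H_{t-1})\|Q_{t,\theta}(\cdot\mid H_{t-1}))\big],\quad \Delta_T^{\mathrm{obs}}(\theta;\pi_\theta)=\sum_{t=1}^T\mathbb{E}_{(H_{t-1},X_t)\sim\mathbb{P}^\star_{\pi_\theta}}\big[\mathrm{KL}(P^{\mathrm{obs}}_{H_{t-1},X_t}\|Q^{\mathrm{obs}}_{H_{t-1},X_t})\big].$$ Assume that for $\mathbb{P}^\star_{\pi_\theta}$-a.e. history $h$ and all $t$: (1) $\mathbb{P}^\star_{\pi_\theta}(X_t=B\mid H_{t-1}=h)\ge\eta$ for some $\eta>0$; and (2) $\delta_s(h)\le(c_{\mathrm{sc}}/s)\,d(h)$ for all $s\ge2$, for some constant $c_{\mathrm{sc}}\in(0,\infty)$. Then $$\Delta_T^{\mathrm{comp}}(\theta;\pi_\theta)\le\frac{1+c_{\mathrm{sc}}\log T}{\eta}\,\Delta_T^{\mathrm{obs}}(\theta;\pi_\theta).$$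
   Context: KL denotes Kullback–Leibler divergence. The learned kernel $Q_{t,\theta}(\cdot\mid h)$ is the law of the completion sampled at round $t$ by the deployed policy. *)

(* Defs.v *)
From HB Require Import structures.
From mathcomp Require Import all_boot all_order all_algebra.
From mathcomp Require Import fingroup perm.
From mathcomp Require Import all_classical all_reals all_analysis.

Set Implicit Arguments.
Unset Strict Implicit.
Unset Printing Implicit Defensive.

Import Order.TTheory GRing.Theory Num.Theory.

Local Open Scope classical_set_scope.
Local Open Scope ring_scope.

Section newsvendor_defs.
Variable R : realType.

(** Kullback-Leibler divergence KL(P || Q) of two (probability) measures on a
    measurable space: if P has a density f = dP/dQ w.r.t. Q (i.e. P << Q,
    for finite measures), KL = \int log f dP; otherwise KL = +oo. *)
Definition is_density d (X : measurableType d) (P Q : set X -> \bar R)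
    (f : X -> R) : Prop :=
  [/\ measurable_fun [set: X] f, (forall x, 0 <= f x) &
      forall A, measurable A -> P A = (\int[Q]_(x in A) (f x)%:E)%E].

Definition KL d (X : measurableType d) (P Q : set X -> \bar R) : \bar R :=
  match pselect (exists f, is_density P Q f) with
  | left H => (\int[P]_x (ln (projT1 (cid H) x))%:E)%E
  | right _ => +oo%E
  end.

Definition psi (x dm : R) : R * bool := (Num.min dm x, dm <= x).

Definition Hist (t : nat) := t.-tuple (R * (R * bool)).

(** Outcome of the interaction: (demands D_{1:T}, actions X_{1:T}),
    rounds indexed 0..T-1.  hist t w = H_{t} (the history before round t,
    0-based), i.e. ((X_s, psi(X_s, D_s)))_{s < t}. *)
Definition hist (T : nat) (t : 'I_T) (w : T.-tuple R * T.-tuple R) : Hist t :=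
  [tuple (tnth w.2 (widen_ord (ltnW (ltn_ord t)) s),
          psi (tnth w.2 (widen_ord (ltnW (ltn_ord t)) s))
              (tnth w.1 (widen_ord (ltnW (ltn_ord t)) s))) | s < t].

Fixpoint arint d (HT : measurableType d)
    (q : forall s : nat, R.-pker (HT * s.-tuple R)%type ~> R) (h : HT)
    (f : seq R -> \bar R) (k : nat) : forall n, n.-tuple R -> \bar R :=
  match k with
  | 0 => fun n p => f p
  | k'.+1 => fun n p =>
      (\int[q n (h, p)]_y arint q h f k' (rcons_tuple p y))%E
  end.

(** Put a sequence generated in the order sigma (position j generates the
    time coordinate sigma j) back in time order. *)
Definition reorder (T : nat) (sigma : {perm 'I_T}) (g : seq R) : T.-tuple R :=
  [tuple nth 0 g ((sigma^-1)%g i) | i < T].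

Definition gen_prefix (T : nat) (sigma : {perm 'I_T}) (dd : T.-tuple R)
    (s : nat) : s.-tuple R :=
  [tuple nth 0 [seq tnth dd (sigma j) | j <- enum 'I_T] j | j < s].

End newsvendor_defs.

(* Main.v *)
Require Import Defs.
From HB Require Import structures.
From mathcomp Require Import all_boot all_order all_algebra.
From mathcomp Require Import fingroup perm.
From mathcomp Require Import all_classical all_reals all_analysis.
From mathcomp Require Import finmap measurable_realfun ring lra.
Import Order.TTheory GRing.Theory Num.Theory.
Import numFieldNormedType.Exports.
Import HBNNSimple.
Local Open Scope classical_set_scope.
Local Open Scope ring_scope.

(** The divergence KL(P || Q) is the least C such that
      int g dP + 1 <= C + a + e^-a int e^g dQ
    for all bounded measurable g >= 0 and all a >= 0 (Donsker-Varadhan duality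
    with the constant [a] left free, which keeps every term nonnegative).
    Generating backwards, the log-moments of g under the learned kernels
    telescope, which gives the chain rule KL(Q*_t || Q_t) <= sum_s delta_s with
    no joint density and no measurability of the conditional divergences.
    With assumption (2) and the harmonic sum this is at most
    (1 + c_sc log T) d(h).  At X_t = B the censoring is inactive, so d(h) is
    also at most the divergence of the observation laws at (h, B).  To integrate
    over X_t = B, an event of conditional probability at least eta, one needs a
    measurable function between these two: the supremum of the dual functional
    over a countable L^1-dense family of simple functions on the line. *)

(** [KL] selects a density by choice, so along a varying history or prefix a divergence is not known
    to be measurable, and its integral is only a supremum over the simple functions below it. This
    integral is monotone, but its additivity cannot be taken for granted. Comparing [eta] times the
    law of the history with the law of the history on [X_t = B] controls measurable integrands only.
    Hence the one-sided rules for sums and multiples, and the measurable majorant of [d(h)]. The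
    dual form suits this, since each step is an inequality for one bounded test function at a time;
    for instance, a function of the demand is a function of the uncensored observation. *)

Set Implicit Arguments.
Unset Strict Implicit.
Unset Printing Implicit Defensive.

(** * Integrals of functions that need not be measurable *)

Section lower_integral.
Local Open Scope ereal_scope.
Context d (X : measurableType d) (R : realType) (mu : {measure set X -> \bar R}).
Implicit Types f g : X -> \bar R.

(* No measurability here: the library integral of a nonnegative function is a
   supremum over the simple functions below it. *)
Lemma ge0_le_integral_lower f g :
  (forall x, 0 <= f x) -> (forall x, f x <= g x) ->
  \int[mu]_x f x <= \int[mu]_x g x.
Proof.
move=> f0 fg; have g0 x : 0 <= g x by exact: le_trans (f0 x) (fg x).
rewrite !ge0_integralTE//; apply: le_ereal_sup => _ [h /= hf <-].
by exists h => // x; exact: le_trans (hf x) (fg x).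
Qed.

(** The null set cannot be cut out of [f] or [g], which need not be measurable, so it is cut out of
    each simple function below [f]: times the indicator of the complement of [N], this keeps its
    integral and lies below [g] everywhere. *)
Lemma ae_ge0_le_integral_lower f g :
  (forall x, 0 <= f x) -> (forall x, 0 <= g x) ->
  {ae mu, forall x, f x <= g x} -> \int[mu]_x f x <= \int[mu]_x g x.
Proof.
move=> f0 g0 [N [mN N0 fgN]]; rewrite ge0_integralTE//.
apply: ge_ereal_sup => _ [h /= hf <-]; rewrite -integralT_nnsfun.
pose h' x := (h x)%:E * (\1_(~` N) x)%:E.
have mh : measurable_fun setT (fun x => (h x)%:E : \bar R) by exact/measurable_EFinP.
rewrite (_ : \int[mu]_x (h x)%:E = \int[mu]_x h' x); last first.
  apply: ge0_ae_eq_integral => //=.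
  - apply: emeasurable_funM => //; apply/measurable_EFinP.
    exact/measurable_indicP/measurableC.
  - by move=> x _; rewrite lee_fin.
  - by move=> x _; rewrite /h' mule_ge0// lee_fin.
  - exists N; split => // x /= /not_implyP[_ nh]; apply: contrapT => Nx.
    by apply: nh; rewrite /h' indicE mem_set// mule1.
apply: ge0_le_integral_lower => x.
  by rewrite /h' mule_ge0// lee_fin.
rewrite /h' indicE; case: (pselect (N x)) => Nx.
  by rewrite memNset ?mule0//; apply.
rewrite mem_set// mule1 (le_trans (hf x))//.
by apply: contrapT => nfg; exact/Nx/fgN.
Qed.

(** A simple function below [c f], divided by [c], lies below [f]. *)
Lemma ge0_integralZl_lower (c : R) f : (0 < c)%R -> (forall x, 0 <= f x) ->
  \int[mu]_x (c%:E * f x) <= c%:E * \int[mu]_x f x.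
Proof.
move=> c0 f0; rewrite ge0_integralTE; last by move=> x; rewrite mule_ge0// lee_fin ltW.
apply: ge_ereal_sup => _ [h /= hf <-]; rewrite -integralT_nnsfun.
have mh : measurable_fun setT (fun x => (h x)%:E : \bar R) by exact/measurable_EFinP.
rewrite (_ : (fun x => (h x)%:E) = (fun x => c%:E * ((c^-1)%:E * (h x)%:E))); last first.
  by apply/funext => x; rewrite -!EFinM mulrA divff ?mul1r// gt_eqF.
rewrite ge0_integralZl//=; last 3 first.
  exact: measurable_funeM.
  by move=> x _; rewrite mule_ge0// lee_fin// invr_ge0 ltW.
  by rewrite lee_fin ltW.
rewrite lee_pmul2l ?lte_fin//.
apply: ge0_le_integral_lower => x; first by rewrite mule_ge0// lee_fin// invr_ge0 ltW.
by rewrite lee_pdivrMl.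
Qed.

(* [g] need not be measurable: only [(a - b)^+ <= g] is integrated. *)
Lemma le_integralD_lower (a b : X -> R) g :
  measurable_fun setT a -> measurable_fun setT b ->
  (forall x, 0 <= a x)%R -> (forall x, 0 <= b x)%R -> (forall x, 0 <= g x) ->
  (forall x, (a x)%:E <= g x + (b x)%:E) ->
  \int[mu]_x (a x)%:E <= \int[mu]_x g x + \int[mu]_x (b x)%:E.
Proof.
move=> ma mb a0 b0 g0 agb.
pose c x := Num.max (a x - b x)%R 0%R.
have mc : measurable_fun setT c.
  by apply: measurable_maxr => //; exact: measurable_funB.
have c0 x : (0 <= c x)%R by rewrite le_max lexx orbT.
apply: (@le_trans _ _ (\int[mu]_x ((c x)%:E + (b x)%:E))).
  apply: ge0_le_integral_lower => x; first by rewrite lee_fin.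
  by rewrite -EFinD lee_fin -lerBlDr le_max lexx.
rewrite ge0_integralD//; last 4 first.
- by move=> x _; rewrite lee_fin.
- exact/measurable_EFinP.
- by move=> x _; rewrite lee_fin.
- exact/measurable_EFinP.
apply: leeD => //; apply: ge0_le_integral_lower => x; first by rewrite lee_fin.
rewrite /c EFin_max ge_max g0 andbT EFinB leeBlDr//.
Qed.

End lower_integral.

(** * Identifying a functional with an integral *)

Section integral_functional.
Local Open Scope ereal_scope.
Context d (X : measurableType d) (R : realType) (mu : {measure set X -> \bar R}).
Variable Phi : (X -> \bar R) -> \bar R.
Hypothesis Phi_indic : forall A, measurable A -> Phi (fun x => (\1_A x)%:E) = mu A.
Hypothesis PhiZ : forall (c : R) f, (0 <= c)%R -> measurable_fun setT f ->
  (forall x, 0 <= f x) -> Phi (fun x => c%:E * f x) = c%:E * Phi f.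
Hypothesis PhiD : forall f g,
  measurable_fun setT f -> (forall x, 0 <= f x) ->
  measurable_fun setT g -> (forall x, 0 <= g x) ->
  Phi (fun x => f x + g x) = Phi f + Phi g.
Hypothesis Phi_lim : forall f_ : nat -> X -> \bar R,
  (forall n, measurable_fun setT (f_ n)) -> (forall n x, 0 <= f_ n x) ->
  (forall x, nondecreasing_seq (f_ ^~ x)) ->
  Phi (fun x => limn (f_ ^~ x)) = limn (fun n => Phi (f_ n)).

Lemma functional_nnsfun (h : {nnsfun X >-> R}) :
  Phi (fun x => (h x)%:E) = \int[mu]_x (h x)%:E.
Proof.
have sumE (s : seq R) : (forall r, r \in s -> 0 <= r)%R ->
    Phi (fun x => \sum_(r <- s) r%:E * (\1_(h @^-1` [set r]) x)%:E)
    = \int[mu]_x (\sum_(r <- s) r%:E * (\1_(h @^-1` [set r]) x)%:E).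
  elim: s => [_|r s IH rs0].
    transitivity (0 : \bar R); last first.
      by apply/esym/integral0_eq => x _; rewrite big_nil.
    (* Homogeneity with the scalar 0 gives [Phi] of the zero function. *)
    rewrite -[RHS](mul0e (Phi (fun x => (\1_set0 x)%:E))) -PhiZ//.
      by congr Phi; apply/funext => x; rewrite big_nil mul0e.
    exact/measurable_EFinP/measurable_indicP.
  have r0 : (0 <= r)%R by apply: rs0; rewrite inE eqxx.
  have s0 r' : r' \in s -> (0 <= r')%R by move=> ?; apply: rs0; rewrite inE orbC; apply/orP; left.
  have mi r' : measurable_fun setT (fun x => (\1_(h @^-1` [set r']) x)%:E : \bar R).
    exact/measurable_EFinP/measurable_indicP.
  have ms : measurable_fun setT (fun x => \sum_(r <- s) r%:E * (\1_(h @^-1` [set r]) x)%:E : \bar R).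
    by apply: emeasurable_sum => r'; exact: measurable_funeM.
  have sge0 x : 0 <= \sum_(r <- s) r%:E * (\1_(h @^-1` [set r]) x)%:E.
    by rewrite big_seq; apply: sume_ge0 => r' /s0 ?; rewrite mule_ge0// lee_fin.
  have rge0 x : 0 <= r%:E * (\1_(h @^-1` [set r]) x)%:E by rewrite mule_ge0// lee_fin.
  under eq_integral do rewrite big_cons.
  rewrite (_ : (fun x => \sum_(i <- r :: s) _) = (fun x => r%:E * (\1_(h @^-1` [set r]) x)%:E
    + \sum_(i <- s) i%:E * (\1_(h @^-1` [set i]) x)%:E)); last first.
    by apply/funext => x; rewrite big_cons.
  rewrite PhiD//; last exact: measurable_funeM.
  rewrite ge0_integralD//; last exact: measurable_funeM.
  rewrite IH// PhiZ//.
  rewrite ge0_integralZl//.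
  by rewrite Phi_indic// integral_indic// setIT.
have hE : (fun x => (h x)%:E) = (fun x =>
    \sum_(r <- fset_set (range h)) r%:E * (\1_(h @^-1` [set r]) x)%:E).
  apply/funext => x; rewrite fimfunE fsbig_finite//= -sumEFin.
  by apply: eq_bigr => r _; rewrite EFinM.
rewrite hE sumE// => r; rewrite in_fset_set; last exact: fimfunP.
by move=> /set_mem[x _ <-].
Qed.

(** The four hypotheses on [Phi] hold for integration against a density and for iterated integration
    along autoregressive kernels; both formulas are given on sets only and are extended to functions
    here. *)
Lemma functionalE f : measurable_fun setT f -> (forall x, 0 <= f x) ->
  Phi f = \int[mu]_x f x.
Proof.
move=> mf f0; pose h := nnsfun_approx measurableT mf.
have hE : f = fun x => limn (fun n => (h n x)%:E).
  apply/funext => x; apply/esym/cvg_lim => //.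
  by apply: cvg_nnsfun_approx => // y _; exact: f0.
have mh n : measurable_fun setT (fun x => (h n x)%:E : \bar R) by exact/measurable_EFinP.
have ndh x : nondecreasing_seq (fun n => (h n x)%:E : \bar R).
  by move=> m n mn; rewrite lee_fin; exact/lefP/nd_nnsfun_approx.
rewrite {1}hE Phi_lim//; last by move=> n x; rewrite lee_fin.
rewrite [in RHS]hE monotone_convergence//; last by move=> n x _; rewrite lee_fin.
by congr (limn _); apply/funext => n; exact: functional_nnsfun.
Qed.

End integral_functional.

(** * Duality for the Kullback-Leibler divergence *)

Section probability_of.
Context d (X : measurableType d) (R : realType) (P : {measure set X -> \bar R}).

(* The dummy proof argument gives the probability instance below its own key. *)
Definition measure1 (_ : P [set: X] = 1%E) : set X -> \bar R := P.

Hypothesis P1 : P [set: X] = 1%E.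

HB.instance Definition _ := Measure.copy (measure1 P1) P.
HB.instance Definition _ := Measure_isProbability.Build _ _ _ (measure1 P1) P1.

Definition probability_of : probability X R := measure1 P1.

End probability_of.

Section density.
Local Open Scope ereal_scope.
Context d (X : measurableType d) (R : realType).
Variables (P Q : {measure set X -> \bar R}) (f : X -> R).
Hypothesis PQf : is_density P Q f.

Lemma ge0_integral_density_ereal (u : X -> \bar R) :
  measurable_fun setT u -> (forall x, 0 <= u x) ->
  \int[P]_x u x = \int[Q]_x (u x * (f x)%:E).
Proof.
move: PQf => [mf f0 Pf] mu u0; apply/esym.
have mF : measurable_fun setT (fun x => (f x)%:E) by exact/measurable_EFinP.
apply: (@functionalE _ _ _ P (fun v => \int[Q]_x (v x * (f x)%:E))
  _ _ _ _ u) => //.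
- move=> A mA; rewrite Pf// [in RHS]integral_mkcond; apply: eq_integral => x _.
  by rewrite patchE indicE; case: ifPn; rewrite ?mul1e ?mul0e.
- move=> c v c0 mv v0; under eq_integral do rewrite -muleA.
  rewrite ge0_integralZl// => [|x _]; first exact: emeasurable_funM.
  by rewrite mule_ge0// lee_fin.
- move=> v w mv v0 mw w0; rewrite -ge0_integralD//.
  + by apply: eq_integral => x _; rewrite ge0_muleDl.
  + by move=> x _; rewrite mule_ge0// lee_fin.
  + exact: emeasurable_funM.
  + by move=> x _; rewrite mule_ge0// lee_fin.
  + exact: emeasurable_funM.
- move=> v_ mv v0 ndv; rewrite -monotone_convergence//.
  + apply: eq_integral => x _; rewrite muleC -limeMl//.
      by congr (limn _); apply/funext => n /=; rewrite muleC.
    by apply: ereal_nondecreasing_is_cvgn; exact: ndv.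
  + by move=> n; exact: emeasurable_funM.
  + by move=> n x _; rewrite mule_ge0// lee_fin.
  + by move=> x _ m n mn; rewrite lee_wpmul2r ?lee_fin//; exact: ndv.
Qed.

Lemma ge0_integral_density (u : X -> R) :
  measurable_fun setT u -> (forall x, 0 <= u x)%R ->
  \int[P]_x (u x)%:E = \int[Q]_x (u x * f x)%:E.
Proof.
move=> mu u0; under [RHS]eq_integral do rewrite EFinM.
rewrite -ge0_integral_density_ereal//; exact/measurable_EFinP.
Qed.

End density.

Section fenchel.
Context d (X : measurableType d) (R : realType).

(** For fixed [g] the right side is least at [a = ln \int[Q] e^g], where it reads [C + a + 1]: this
    is the Donsker-Varadhan inequality. Taking [0 <= g] loses nothing, since adding a constant to
    [g] shifts both sides of that inequality equally, and it makes the optimal [a] nonnegative. *)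
Definition fenchel_bound (P Q : set X -> \bar R) (C : \bar R) := forall (g : X -> R) (M a : R),
  measurable_fun setT g -> (forall x, 0 <= g x <= M) -> 0 <= a ->
  (\int[P]_x (g x)%:E + 1 <= C + a%:E + (expR (- a))%:E * \int[Q]_x (expR (g x))%:E)%E.

Lemma bounded_integralE (P : probability X R) (g : X -> R) (M : R) :
  measurable_fun setT g -> (forall x, 0 <= g x <= M) ->
  exists2 r : R, 0 <= r <= M & (\int[P]_x (g x)%:E)%E = r%:E.
Proof.
move=> mg g0M; have g0 x : 0 <= g x by have /andP[] := g0M x.
have gM x : g x <= M by have /andP[] := g0M x.
have I0 : (0 <= \int[P]_x (g x)%:E)%E by apply: integral_ge0 => x _; rewrite lee_fin.
have IM : (\int[P]_x (g x)%:E <= M%:E)%E.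
  rewrite -[leRHS]mule1 -(probability_setT P) -integral_cst//.
  by apply: ge0_le_integral_lower => x; rewrite lee_fin.
have If : (\int[P]_x (g x)%:E)%E \is a fin_num.
  by rewrite ge0_fin_numE// (le_lt_trans IM)// ltry.
exists (fine (\int[P]_x (g x)%:E)%E); last by rewrite fineK.
by rewrite -!lee_fin fineK// I0 IM.
Qed.

Lemma measurable_expR_comp (g : X -> R) : measurable_fun setT g ->
  measurable_fun setT (fun x => expR (g x)).
Proof. by move=> mg; exact: measurableT_comp. Qed.

Lemma bounded_integral_expRE (P : probability X R) (g : X -> R) (M : R) :
  measurable_fun setT g -> (forall x, 0 <= g x <= M) ->
  exists2 r : R, 1 <= r & (\int[P]_x (expR (g x))%:E)%E = r%:E.
Proof.
move=> mg g0M; have me := measurable_expR_comp mg.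
have [x|r /andP[r0 _] rE] := @bounded_integralE P (fun x => expR (g x)) (expR M) me.
  by rewrite expR_ge0 ler_expR; have /andP[] := g0M x.
exists r => //; rewrite -lee_fin -rE -(probability_setT P) -[leLHS]mul1e -integral_cst//.
apply: ge0_le_integral_lower => x; rewrite ?lee_fin//.
by rewrite -expR0 ler_expR; have /andP[] := g0M x.
Qed.

(* Young's inequality [y s <= y ln y - y + e^s] at [s = g - a], with the
   positive and negative parts of [ln y] kept on separate sides. *)
Lemma young_ln (y g a : R) : 0 <= y ->
  g * y + Num.max (- ln y) 0 * y + y
  <= Num.max (ln y) 0 * y + a * y + expR (- a) * expR g.
Proof.
rewrite le_eqVlt => /predU1P[<-|y0].
  by rewrite !mulr0 !addr0 add0r mulr_ge0// expR_ge0.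
set L := ln y.
have -> : expR (- a) * expR g = y * expR (g - a - L).
  rewrite !expRD expRN (_ : expR (- L) = y^-1); last by rewrite expRN lnK.
  by field; rewrite ?gt_eqF ?expR_gt0//.
have h : y * (1 + (g - a - L)) <= y * expR (g - a - L) by rewrite ler_pM2l// expR_ge1Dx.
have -> : Num.max L 0 = L + Num.max (- L) 0.
  have [L0|L0] := leP L 0; first by rewrite max_l ?subrr// oppr_ge0.
  by rewrite max_r ?addr0// oppr_le0 ltW.
lra.
Qed.

(** [expR x >= 1 + x] at [x = - ln y] gives [- y ln y <= 1 - y]. *)
Lemma lnN_mul_le1 (y : R) : 0 <= y -> Num.max (- ln y) 0 * y <= 1.
Proof.
rewrite le_eqVlt => /predU1P[<-|y0]; first by rewrite mulr0.
have yV : expR (- ln y) = y^-1 by rewrite expRN lnK.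
have h : y * (1 + - ln y) <= y * expR (- ln y) by rewrite ler_pM2l// expR_ge1Dx.
rewrite yV mulfV ?gt_eqF// in h.
by have [_|_] := leP (- ln y) 0; nra.
Qed.

Lemma ge0_integralD_EFin (P : {measure set X -> \bar R}) (u v : X -> R) :
  measurable_fun setT u -> measurable_fun setT v ->
  (forall x, 0 <= u x) -> (forall x, 0 <= v x) ->
  (\int[P]_x (u x + v x)%:E = \int[P]_x (u x)%:E + \int[P]_x (v x)%:E)%E.
Proof.
move=> mu mv u0 v0; under eq_integral do rewrite EFinD.
by rewrite ge0_integralD//;
  [move=> x _; rewrite lee_fin|exact/measurable_EFinP|
   move=> x _; rewrite lee_fin|exact/measurable_EFinP].
Qed.

Lemma ge0_integralZ_EFin (P : {measure set X -> \bar R}) (c : R) (u : X -> R) :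
  0 <= c -> measurable_fun setT u -> (forall x, 0 <= u x) ->
  (\int[P]_x (c * u x)%:E = c%:E * \int[P]_x (u x)%:E)%E.
Proof.
move=> c0 mu u0; under eq_integral do rewrite EFinM.
by rewrite ge0_integralZl_EFin//; [move=> x _; rewrite lee_fin|exact/measurable_EFinP].
Qed.

Lemma integral_cst_probability (P : probability X R) (c : R) :
  (\int[P]_x c%:E = c%:E)%E.
Proof. by rewrite integral_cst// [X in (_ * X)%E]probability_setT mule1. Qed.

(** By [lnN_mul_le1] the integral is at most 1, so the integral of [ln f] under [P] is never of the
    form [oo - oo]. *)
Lemma integral_lnN_density (P Q : probability X R) f : is_density P Q f ->
  exists2 b : R, 0 <= b & (\int[P]_x (Num.max (- ln (f x)) 0)%:E)%E = b%:E.
Proof.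
move=> PQf; have [mf f0 _] := PQf.
have I0 : (0 <= \int[P]_x (Num.max (- ln (f x)) 0)%:E)%E.
  by apply: integral_ge0 => x _; rewrite lee_fin le_max lexx orbT.
have I1 : (\int[P]_x (Num.max (- ln (f x)) 0)%:E <= 1%:E)%E.
  rewrite (ge0_integral_density PQf); last 2 first.
  - apply: measurable_maxr => //; apply: measurableT_comp => //.
    exact: measurableT_comp.
  - by move=> x; rewrite le_max lexx orbT.
  rewrite -(integral_cst_probability Q 1); apply: ge0_le_integral_lower => x.
    by rewrite lee_fin mulr_ge0// le_max lexx orbT.
  by rewrite lee_fin lnN_mul_le1.
have If : (\int[P]_x (Num.max (- ln (f x)) 0)%:E)%E \is a fin_num.
  by rewrite ge0_fin_numE// (le_lt_trans I1)// ltry.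
exists (fine (\int[P]_x (Num.max (- ln (f x)) 0)%:E)%E); last by rewrite fineK.
by rewrite -lee_fin fineK.
Qed.

Lemma integral_lnE (P : {measure set X -> \bar R}) (f : X -> R) :
  (\int[P]_x (ln (f x))%:E = \int[P]_x (Num.max (ln (f x)) 0)%:E
                          - \int[P]_x (Num.max (- ln (f x)) 0)%:E)%E.
Proof.
by rewrite integralE; congr (_ - _)%E; apply: eq_integral => x _;
  rewrite ?funeposE ?funenegE EFin_max.
Qed.

(** The easy half of the duality: [young_ln] at [y = dP/dQ], integrated over [Q]. Both sides are
    sums of nonnegative terms, so the positive part of the log-density may have infinite
    integral. *)
Lemma fenchel_KL (P Q : probability X R) : fenchel_bound P Q (KL P Q).
Proof.
move=> g M a mg g0M a0.
have [e e1 eE] := bounded_integral_expRE Q mg g0M.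
have [r /andP[r0 rM] rE] := bounded_integralE P mg g0M.
rewrite /KL; case: pselect => [H|_]; last by rewrite eE -EFinM addye// leey.
move: (projT2 (cid H)); set f := projT1 (cid H) => PQf.
have [mf f0 Pf] := PQf.
have mln : measurable_fun setT (fun x => ln (f x)) by exact: measurableT_comp.
have mLp : measurable_fun setT (fun x => Num.max (ln (f x)) 0).
  exact: measurable_maxr.
have mLn : measurable_fun setT (fun x => Num.max (- ln (f x)) 0).
  by apply: measurable_maxr => //; exact: measurableT_comp.
have Lp0 x : 0 <= Num.max (ln (f x)) 0 by rewrite le_max lexx orbT.
have Ln0 x : 0 <= Num.max (- ln (f x)) 0 by rewrite le_max lexx orbT.
have g0 x : 0 <= g x by have /andP[] := g0M x.
have [b b0 bE] := integral_lnN_density PQf.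
have : (\int[P]_x (g x + Num.max (- ln (f x)) 0 + 1)%:E <=
    \int[P]_x (Num.max (ln (f x)) 0 + a)%:E + \int[Q]_x (expR (- a) * expR (g x))%:E)%E.
  rewrite (ge0_integral_density PQf); last 2 first.
  - by do 2 apply: measurable_funD => //.
  - by move=> x; rewrite !addr_ge0.
  rewrite (ge0_integral_density PQf); last 2 first.
  - exact: measurable_funD.
  - by move=> x; rewrite !addr_ge0.
  rewrite -ge0_integralD_EFin; last 4 first.
  - by apply: measurable_funM => //; exact: measurable_funD.
  - by apply: measurable_funM => //; exact: measurable_expR_comp.
  - by move=> x; rewrite mulr_ge0// addr_ge0.
  - by move=> x; rewrite mulr_ge0// expR_ge0.
  apply: ge0_le_integral_lower => x; rewrite lee_fin.
    by rewrite mulr_ge0// !addr_ge0.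
  by rewrite !mulrDl mul1r; exact: young_ln.
rewrite ge0_integralD_EFin//; last 2 first.
- exact: measurable_funD.
- by move=> x; rewrite addr_ge0.
rewrite ge0_integralD_EFin// ge0_integralD_EFin//.
rewrite !integral_cst_probability.
rewrite [X in (_ <= _ + X)%E -> _]ge0_integralZ_EFin ?expR_ge0//; last first.
  exact: measurable_expR_comp.
rewrite integral_lnE rE eE bE.
case: (\int[P]_x _)%E => [p| |] //.
by rewrite -!EFinM -!EFinD -?EFinB -?EFinD !lee_fin => ?; lra.
by move=> _; rewrite -EFinM -EFinN ?addye// leey.
Qed.

Lemma KL_ge0 (P Q : probability X R) : (0 <= KL P Q)%E.
Proof.
have h0 (x : X) : 0 <= (0 : R) <= 0 by rewrite lexx.
have := fenchel_KL P Q (measurable_cst (0 : R)) h0 (lexx 0).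
rewrite oppr0 /= expR0 !integral_cst_probability mul1e adde0.
by rewrite leeD2rE.
Qed.

End fenchel.

(** * The converse half of the duality *)

Section fenchel_hard.
Context d (X : measurableType d) (R : realType).

(** If [Q A = 0], the test function [n 1_A] has exponential moment 1 under [Q], so [n P(A) <= c] for
    every [n]. *)
Lemma fenchel_dominates (P Q : probability X R) (c : R) :
  fenchel_bound P Q c%:E -> P `<< Q.
Proof.
move=> PQ; apply/null_content_dominatesP => A mA QA0.
have PA : P A \is a fin_num by exact: fin_num_measure.
rewrite -(fineK PA); congr EFin; apply/eqP; rewrite eq_le fine_ge0// andbT.
rewrite leNgt; apply/negP => PA0.
have np n : n%:R * fine (P A) <= c.
  have mg : measurable_fun setT (fun x => n%:R * (\1_A x : R)).
    by apply: measurable_funM => //; exact/measurable_indicP.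
  have g01 x : 0 <= n%:R * (\1_A x : R) <= n%:R.
    by rewrite indicE; case: (_ \in _); rewrite ?mulr1 ?mulr0 ?lexx ler0n.
  have := PQ _ _ 0 mg g01 (lexx _); rewrite oppr0 expR0 mul1e adde0.
  rewrite ge0_integralZ_EFin//.
  rewrite integral_indic// setIT => h.
  suff E1 : (\int[Q]_x (expR (n%:R * (\1_A x : R)))%:E <= 1%:E)%E.
    have := le_trans h (leeD2l _ E1).
    rewrite [X in (_ * X + _)%E](_ : _ = (fine (P A))%:E); last by rewrite fineK.
    by rewrite -EFinM -!EFinD lee_fin; lra.
  apply: (@le_trans _ _ (\int[Q]_x (1 + expR n%:R * (\1_A x : R))%:E)%E).
    apply: ge0_le_integral_lower => x; rewrite lee_fin ?expR_ge0//.
    rewrite indicE; case: (_ \in _); rewrite ?mulr1 ?mulr0 ?addr0 ?expR0//.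
    by rewrite lerDr.
  have mi : measurable_fun setT (fun x => expR n%:R * (\1_A x : R)).
    by apply: measurable_funM => //; exact/measurable_indicP.
  have i0 x : 0 <= expR n%:R * (\1_A x : R) by rewrite mulr_ge0// expR_ge0.
  have mA1 : measurable_fun setT (\1_A : X -> R) by exact/measurable_indicP.
  rewrite ge0_integralD_EFin//.
  rewrite ge0_integralZ_EFin ?expR_ge0//.
  by rewrite integral_indic// setIT QA0 mule0 adde0 integral_cst_probability.
have [n /ltW hn] : exists n : nat, (c + 1) / fine (P A) < n%:R.
  exists (Num.bound `|(c + 1) / fine (P A)|).
  by rewrite (le_lt_trans (ler_norm _))// archi_boundP.
by move: hn; rewrite ler_pdivrMr// => hn; have := le_trans hn (np n); rewrite gerDl ler10.
Qed.

(** The dual functional is maximal at [ln f], which need be neither bounded nor nonnegative;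
    truncations of it serve as test functions, and monotone convergence removes the truncation. *)
Lemma fenchel_integral_lnp (P Q : probability X R) f (c b : R) :
  is_density P Q f -> fenchel_bound P Q c%:E ->
  (\int[P]_x (Num.max (- ln (f x)) 0)%:E)%E = b%:E ->
  (\int[P]_x (Num.max (ln (f x)) 0)%:E <= (c + b)%:E)%E.
Proof.
move=> PQf PQ bE; have [mf f0 Pf] := PQf.
have mln : measurable_fun setT (fun x => ln (f x)) by exact: measurableT_comp.
pose Lp x := Num.max (ln (f x)) 0; pose Ln x := Num.max (- ln (f x)) 0.
have mLp : measurable_fun setT Lp by exact: measurable_maxr.
have mLn : measurable_fun setT Ln.
  by apply: measurable_maxr => //; exact: measurableT_comp.
have Lp0 x : 0 <= Lp x by rewrite le_max lexx orbT.
have Ln0 x : 0 <= Ln x by rewrite le_max lexx orbT.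
pose L_ (n : nat) x := Num.min (Lp x) n%:R.
have mL_ n : measurable_fun setT (L_ n) by exact: measurable_minr.
have L_0 n x : 0 <= L_ n x by rewrite le_min Lp0 ler0n.
have bound n : (\int[P]_x (L_ n x)%:E <= (c + b + expR (- n%:R))%:E)%E.
  (* [ln f] is cut to [[-n, n]] and shifted up by [n]; the choice [a = n] below undoes the shift. *)
  pose l x := Num.min (ln (Num.max (f x) (expR (- n%:R)))) n%:R.
  pose g x := l x + n%:R.
  have ml : measurable_fun setT l.
    apply: measurable_minr => //; apply: measurableT_comp => //.
    exact: measurable_maxr.
  have mg : measurable_fun setT g by exact: measurable_funD.
  have max0 x : 0 < Num.max (f x) (expR (- n%:R)) by rewrite lt_max expR_gt0 orbT.
  have g0M x : 0 <= g x <= n%:R + n%:R.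
    rewrite /g lerD2r ge_min lexx orbT andbT -lerBlDr sub0r le_min.
    rewrite -ler_expR lnK ?posrE// le_max lexx orbT /=.
    by rewrite (@le_trans _ _ 0)// oppr_le0.
  have g0 x : 0 <= g x by have /andP[] := g0M x.
  have [G _ GE] := bounded_integralE P mg g0M.
  have := PQ _ _ n%:R mg g0M (ler0n _ _).
  rewrite GE.
  have [e _ eE] := bounded_integral_expRE Q mg g0M.
  (* [e^(g - n) <= max (f, e^-n) <= f + e^-n], and [f] has [Q]-integral 1. *)
  have : ((expR (- n%:R))%:E * \int[Q]_x (expR (g x))%:E <= (1 + expR (- n%:R))%:E)%E.
    rewrite -ge0_integralZ_EFin ?expR_ge0//; last exact: measurable_expR_comp.
    rewrite EFinD -(integral_cst_probability Q (expR _)).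
    rewrite [X in (_ <= X + _)%E](_ : _ = \int[Q]_x (f x)%:E)%E; last first.
      by rewrite -Pf// probability_setT.
    rewrite -ge0_integralD_EFin//.
    apply: ge0_le_integral_lower => x.
      by rewrite lee_fin mulr_ge0// expR_ge0.
    rewrite lee_fin -expRD addrC addrK.
    apply: (@le_trans _ _ (Num.max (f x) (expR (- n%:R)))).
      rewrite -[leRHS]lnK ?posrE// ler_expR ge_min lexx//.
    by rewrite ge_max lerDl lerDr expR_ge0 f0.
  rewrite eE.
  (* The change of measure to [Q] puts the factor [f] on both sides, so points with [f = 0], where
     [ln f] is a default value, do not count. *)
  have : (\int[P]_x (L_ n x + n%:R)%:E <= \int[P]_x (g x + Ln x)%:E)%E.
    rewrite (ge0_integral_density PQf); last 2 first.
    - exact: measurable_funD.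
    - by move=> x; rewrite addr_ge0.
    rewrite (ge0_integral_density PQf); last 2 first.
    - exact: measurable_funD.
    - by move=> x; rewrite addr_ge0.
    apply: ge0_le_integral_lower => x; rewrite lee_fin.
      by rewrite mulr_ge0// addr_ge0.
    have := f0 x; rewrite le_eqVlt => /predU1P[<-|fx0]; first by rewrite !mulr0.
    rewrite ler_pM2r// /g addrAC lerD2r /L_ /Lp /Ln.
    have lL : ln (f x) <= ln (Num.max (f x) (expR (- n%:R))).
      by rewrite ler_ln ?posrE// le_max lexx.
    have n0 : 0 <= n%:R :> R by rewrite ler0n.
    have [L0|L0] := leP (ln (f x)) 0.
      rewrite max_l ?oppr_ge0// (@le_trans _ _ 0) ?ge_min ?lexx// subr_ge0 le_min lL.
      exact: le_trans L0 n0.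
    rewrite max_r ?oppr_le0 ?(ltW L0)// addr0 /l le_min ge_min lL /=.
    by rewrite ge_min lexx orbT.
  rewrite ge0_integralD_EFin// integral_cst_probability.
  rewrite [X in (_ <= X -> _)%E]ge0_integralD_EFin// GE bE.
  case: (\int[P]_x _)%E => [p| |] //.
    by rewrite -EFinM -!EFinD !lee_fin => *; lra.
  by move=> *; exact: leNye.
rewrite [leLHS](_ : _ = \int[P]_x limn (fun n => (L_ n x)%:E))%E; last first.
  apply: eq_integral => x _; apply/esym/cvg_lim => //; apply: cvg_near_cst.
  near=> n; rewrite /L_ min_l//; near: n.
  exact: nbhs_infty_ger.
have ndL x : nondecreasing_seq (fun n => (L_ n x)%:E : \bar R).
  move=> m n mn; rewrite lee_fin /L_ le_min ge_min lexx /=.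
  by rewrite ge_min ler_nat mn orbT.
have mLE n : measurable_fun setT (fun x => (L_ n x)%:E : \bar R).
  exact/measurable_EFinP.
rewrite monotone_convergence//; last by move=> n x _; rewrite lee_fin.
apply/lee_addgt0Pr => eps eps0; apply: lime_le.
  apply: ereal_nondecreasing_is_cvgn => m n mn.
  by apply: ge0_le_integral_lower => x; [rewrite lee_fin|exact: ndL].
near=> n; apply: (le_trans (bound n)); rewrite -EFinD lee_fin lerD2l.
rewrite expRN invf_ple ?posrE ?expR_gt0//.
apply: (@le_trans _ _ (1 + n%:R)); last exact: expR_ge1Dx.
rewrite (@le_trans _ _ n%:R) ?lerDr//; near: n.
exact: nbhs_infty_ger.
Unshelve. all: by end_near.
Qed.

(** A finite bound forces [P << Q], so Radon-Nikodym gives a density and the branch [+oo] of [KL]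
    cannot occur. As [KL] picks its density by choice, [fenchel_integral_lnp] is stated for an
    arbitrary one. *)
Lemma KL_le_fenchel (P Q : probability X R) C : fenchel_bound P Q C -> (KL P Q <= C)%E.
Proof.
case: C => [c| |] PQ; last 2 first.
- exact: leey.
- have h0 (x : X) : 0 <= (0 : R) <= 0 by rewrite lexx.
  have := PQ _ _ _ (measurable_cst (0 : R)) h0 (lexx 0).
  by rewrite /= expR0 !integral_cst_probability -EFinM -EFinD.
rewrite /KL; case: pselect => [H|nH].
  move: (projT2 (cid H)); set f := projT1 (cid H) => PQf.
  have [b b0 bE] := integral_lnN_density PQf.
  rewrite integral_lnE bE leeBlDr// -EFinD.
  exact: (fenchel_integral_lnp PQf PQ bE).
exfalso; apply: nH.
have [f [f0 ffin fint Pf]] := radon_nikodym_sigma_finite (fenchel_dominates PQ).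
exists (fine \o f); split => /=.
- apply/measurable_EFinP; rewrite (_ : _ \o _ = f).
    by have /integrableP[] := fint.
  by apply/funext => x /=; rewrite fineK.
- by move=> x; exact/fine_ge0/f0.
- by move=> A mA; rewrite Pf//; apply: eq_integral => x _; rewrite fineK.
Qed.

End fenchel_hard.

(** * A countable family of simple functions dense in L1 *)

Section step_functions.
Context (R : realType).

(* The codes form a countable type; they denote a family of simple functions
   on the real line that is dense in [L^1] of every finite measure. *)
Fixpoint step_fun (c : GenTree.tree rat) (x : R) : R :=
  match c with
  | GenTree.Leaf q => \1_(`]ratr q, +oo[ : set R) x
  | GenTree.Node 0 [:: a; b] => step_fun a x + step_fun b x
  | GenTree.Node 1 [:: a; b] => Num.max (step_fun a x - step_fun b x) 0
  | GenTree.Node n.+2 [:: a] => n.+1%:R^-1 * step_fun a x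
  | GenTree.Node 2 [::] => 1
  | _ => 0
  end.

Lemma step_funP c : measurable_fun setT (step_fun c) /\
  exists M, forall x, 0 <= step_fun c x <= M.
Proof.
move: c; fix IH 1 => -[q|n s].
  have mI : measurable_fun setT (\1_(`]ratr q, +oo[ : set R) : R -> R).
    by apply/measurable_indicP; exact: measurable_itv.
  split; first exact: mI.
  by exists 1 => x /=; rewrite indicE; case: (_ \in _); rewrite /= ?lexx ?ler01.
have cst0 (c : R) : 0 <= c -> measurable_fun setT (fun _ : R => c) /\
    exists M, forall x : R, 0 <= c <= M.
  by move=> c0; split; [exact: measurable_cst|exists c => x; rewrite c0 lexx].
case: s => [|a [|b [|e s]]]; case: n => [|[|[|n]]] /=; try exact: cst0.
- have [ma [M aM]] := IH a; split; first exact: measurable_funM.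
  exists M => x; rewrite invr1 mul1r; exact: aM.
- have [ma [M aM]] := IH a; split; first exact: measurable_funM.
  exists (n.+2%:R^-1 * M) => x; have /andP[a0 a1] := aM x.
  by rewrite mulr_ge0//= ler_wpM2l.
- have [ma [M aM]] := IH a; have [mb [N bN]] := IH b.
  split; first exact: measurable_funD.
  exists (M + N) => x; have /andP[a0 a1] := aM x; have /andP[b0 b1] := bN x.
  by rewrite addr_ge0//= lerD.
- have [ma [M aM]] := IH a; have [mb [N bN]] := IH b.
  split; first by apply: measurable_maxr => //; exact: measurable_funB.
  exists M => x; have /andP[a0 a1] := aM x; have /andP[b0 b1] := bN x.
  rewrite le_max lexx orbT ge_max (le_trans a0 a1) andbT /=.
  by rewrite lerBlDr (le_trans a1)// lerDl.
Qed.

Lemma measurable_step_fun c : measurable_fun setT (step_fun c).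
Proof. by have [] := step_funP c. Qed.

Lemma step_fun_ge0 c x : 0 <= step_fun c x.
Proof. by have [_ [M /(_ x)/andP[]]] := step_funP c. Qed.

Section density.
Variable mu : {measure set R -> \bar R}.
Hypothesis mu_fin : (mu setT < +oo)%E.

Definition approximable (g : R -> R) := forall e : R, 0 < e ->
  exists c, (\int[mu]_x `|g x - step_fun c x|%:E <= e%:E)%E.

Let mdist (g h : R -> R) : measurable_fun setT g -> measurable_fun setT h ->
  measurable_fun setT (fun x => `|g x - h x|).
Proof. by move=> mg mh; apply: measurableT_comp => //; exact: measurable_funB. Qed.

Lemma integral_dist_le (u : R -> R) (g h g' h' : R -> R) (e1 e2 : R) :
  measurable_fun setT g -> measurable_fun setT h ->
  measurable_fun setT g' -> measurable_fun setT h' ->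
  (forall x, 0 <= u x <= `|g x - h x| + `|g' x - h' x|) ->
  (\int[mu]_x `|g x - h x|%:E <= e1%:E)%E ->
  (\int[mu]_x `|g' x - h' x|%:E <= e2%:E)%E ->
  (\int[mu]_x (u x)%:E <= (e1 + e2)%:E)%E.
Proof.
move=> mg mh mg' mh' ule i1 i2.
apply: (@le_trans _ _ (\int[mu]_x (`|g x - h x| + `|g' x - h' x|)%:E)%E).
  by apply: ge0_le_integral_lower => x; rewrite lee_fin; have /andP[] := ule x.
have m1 := mdist mg mh; have m2 := mdist mg' mh'.
by rewrite ge0_integralD_EFin// EFinD leeD.
Qed.

Lemma approximable_step c : approximable (step_fun c).
Proof.
move=> e e0; exists c; rewrite integral0_eq ?lee_fin ?ltW// => x _.
by rewrite subrr normr0.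
Qed.

Lemma approximable_closed (g : R -> R) : measurable_fun setT g ->
  (forall e : R, 0 < e -> exists2 h, measurable_fun setT h /\ approximable h &
     (\int[mu]_x `|g x - h x|%:E <= e%:E)%E) -> approximable g.
Proof.
move=> mg gh e e0; have e2 : 0 < e / 2 by rewrite divr_gt0.
have [h [mh ah] ghe] := gh _ e2; have [c hc] := ah _ e2.
exists c; rewrite [e]splitr.
apply: (integral_dist_le mg mh mh (measurable_step_fun c)) => // x.
by rewrite normr_ge0 /= -(subrKA (h x) (g x)) ler_normD.
Qed.

Lemma approximableD (g h : R -> R) : measurable_fun setT g -> measurable_fun setT h ->
  approximable g -> approximable h -> approximable (fun x => g x + h x).
Proof.
move=> mg mh ag ah e e0; have e2 : 0 < e / 2 by rewrite divr_gt0.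
have [a ga] := ag _ e2; have [b hb] := ah _ e2.
exists (GenTree.Node 0 [:: a; b]); rewrite [e]splitr.
apply: (integral_dist_le mg (measurable_step_fun a) mh (measurable_step_fun b)) => // x.
by rewrite normr_ge0 /= opprD addrACA ler_normD.
Qed.

(** [(y - z)^+] is 1-Lipschitz in [y] and in [z]. Truncated differences stand in for subtraction,
    which would leave the nonnegative functions. *)
Lemma approximable_subp (g h : R -> R) : measurable_fun setT g -> measurable_fun setT h ->
  approximable g -> approximable h -> approximable (fun x => Num.max (g x - h x) 0).
Proof.
move=> mg mh ag ah e e0; have e2 : 0 < e / 2 by rewrite divr_gt0.
have [a ga] := ag _ e2; have [b hb] := ah _ e2.
exists (GenTree.Node 1 [:: a; b]); rewrite [e]splitr.
apply: (integral_dist_le mg (measurable_step_fun a) mh (measurable_step_fun b)) => // x.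
rewrite normr_ge0 /=.
move: (g x) (h x) (step_fun a x) (step_fun b x) => y z s t.
have := ler_norm (y - s); have := ler_norm (s - y); rewrite (distrC s).
have := ler_norm (z - t); have := ler_norm (t - z); rewrite (distrC t).
move: `|y - s| `|z - t| => u v h1 h2 h3 h4.
have [h5|h5] := leP (y - z) 0; have [h6|h6] := leP (s - t) 0;
  rewrite ler_norml; apply/andP; split; lra.
Qed.

Lemma approximableV n (g : R -> R) : measurable_fun setT g ->
  approximable g -> approximable (fun x => n.+1%:R^-1 * g x).
Proof.
move=> mg ag e e0; have [c gc] := ag _ e0.
exists (GenTree.Node n.+2 [:: c]); apply: le_trans gc.
apply: ge0_le_integral_lower => x; rewrite lee_fin//.
have -> : step_fun (GenTree.Node n.+2 [:: c]) x = n.+1%:R^-1 * step_fun c x.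
  by case: n => [|n] //=; rewrite invr1 mul1r.
rewrite -mulrBr normrM ger0_norm// ler_piMl// invf_le1//.
by rewrite ler1n.
Qed.

Lemma approximable1 : approximable (fun=> 1).
Proof. exact: (@approximable_step (GenTree.Node 2 [::])). Qed.

Lemma approximable0 : approximable (fun=> 0).
Proof. exact: (@approximable_step (GenTree.Node 0 [::])). Qed.

Lemma approximable_indicU (A B : set R) : measurable A -> measurable B ->
  approximable (\1_A : R -> R) -> approximable (\1_B : R -> R) ->
  approximable (\1_(A `|` B) : R -> R).
Proof.
move=> mA mB aA aB.
have mA1 : measurable_fun setT (\1_A : R -> R) by exact/measurable_indicP.
have mB1 : measurable_fun setT (\1_B : R -> R) by exact/measurable_indicP.
rewrite (_ : \1_(A `|` B) = fun x => \1_A x + Num.max (\1_B x - \1_A x) 0); last first.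
  apply/funext => x; rewrite !indicE in_setU.
  by case: (x \in A); case: (x \in B); rewrite /= ?subrr ?subr0 ?sub0r ?maxxx ?addr0 ?add0r //;
    [rewrite max_r ?addr0// lerN10|rewrite max_l].
apply: approximableD => //; last exact: approximable_subp.
by apply: measurable_maxr => //; exact: measurable_funB.
Qed.

(** The measurable sets with approximable indicator form a sigma-algebra containing the rays, which
    generate the Borel sets. *)
Lemma approximable_indic (A : set R) : measurable A -> approximable (\1_A : R -> R).
Proof.
have mI (B : set R) : measurable B -> measurable_fun setT (\1_B : R -> R).
  by move=> mB; apply/measurable_indicP.
pose K := [set A : set R | measurable A /\ approximable (\1_A : R -> R)].
have K0 : K set0.
  split => //; rewrite (_ : \1_set0 = fun=> 0); first exact: approximable0.
  by apply/funext => x; rewrite indicE in_set0.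
have KC A' : K A' -> K (~` A').
  move=> [mA aA]; split; first exact: measurableC.
  rewrite (_ : \1_(~` A') = fun x => Num.max (1 - \1_A' x) 0); last first.
    apply/funext => x; rewrite !indicE in_setC.
    by case: (x \in A'); rewrite /= ?subrr ?subr0 ?maxxx// max_l.
  exact: (approximable_subp (measurable_cst (1 : R)) (mI _ mA) approximable1 aA).
have Kbig (F : nat -> set R) n : (forall i, K (F i)) -> K (\big[setU/set0]_(i < n) F i).
  move=> KF; elim/big_ind : _ => //= B C [mB aB] [mC aC].
  by split; [exact: measurableU|exact: approximable_indicU].
(* Finite unions increase to the countable one, and as [mu] is finite the measure of the difference
   tends to 0. *)
have Kcup (F : nat -> set R) : (forall i, K (F i)) -> K (\bigcup_i F i).
  move=> KF; have mF i : measurable (F i) by have [] := KF i.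
  have mU : measurable (\bigcup_i F i) by exact: bigcup_measurable.
  split => //; apply: (approximable_closed (mI _ mU)) => e e0.
  pose G n := \big[setU/set0]_(i < n) F i.
  have GU : \bigcup_n G n = \bigcup_i F i.
    apply/seteqP; split => [x [n _]|x [i _ Fx]].
      by rewrite /G -bigcup_mkord => -[i _ Fx]; exists i.
    by exists i.+1 => //; rewrite /G -bigcup_mkord; exists i => /=.
  have mG n : measurable (G n) by have [] := Kbig F n KF.
  have cvgG : (mu \o G) n @[n --> \oo] --> mu (\bigcup_i F i).
    rewrite -GU; apply: nondecreasing_cvg_mu => //; first by rewrite GU.
    by move=> m n mn; rewrite subsetEset; exact: subset_bigsetU.
  have fU : mu (\bigcup_i F i) \is a fin_num.
    rewrite ge0_fin_numE// (le_lt_trans _ mu_fin)//.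
    apply: le_measure; [exact: mem_set|exact: (mem_set measurableT)|exact: subsetT].
  have [n Hn] : exists n, (mu (\bigcup_i F i) - e%:E <= mu (G n))%E.
    apply: contrapT => /forallNP nH.
    have : (mu (\bigcup_i F i) <= mu (\bigcup_i F i) - e%:E)%E.
      rewrite -{1}(cvg_lim _ cvgG)//; apply: lime_le; first exact: cvgP cvgG.
      by apply: nearW => n; have /negP := nH n; rewrite -ltNge => /ltW.
    by rewrite -(fineK fU) -EFinB lee_fin; lra.
  exists (\1_(G n)).
    by have [mGn aGn] := Kbig F n KF; split => //; exact: mI.
  have GF : G n `<=` \bigcup_i F i by rewrite -GU; exact: bigcup_sup.
  have fG : mu (G n) \is a fin_num.
    rewrite ge0_fin_numE// (le_lt_trans _ mu_fin)//.
    apply: le_measure; [exact: mem_set|exact: (mem_set measurableT)|exact: subsetT].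
  have -> : (\int[mu]_x `|\1_(\bigcup_i F i) x - \1_(G n) x|%:E)%E
      = (\int[mu]_x (\1_(\bigcup_i F i `\` G n) x)%:E)%E.
    apply: eq_integral => x _; rewrite !indicE in_setD.
    have [xG|xG] := boolP (x \in G n).
      by rewrite (mem_set (GF _ (set_mem xG))) /= subrr normr0.
    by rewrite andbT subr0 normr_nat.
  rewrite integral_indic//; last exact: measurableD.
  rewrite setIT measureD//; last by rewrite -ge0_fin_numE.
  by rewrite setIidr// leeBlDr// addeC -leeBlDr.
have KG : @RGenOInfty.G R `<=` K.
  move=> _ [x ->].
  (* The ray from [x] is the union of the rays from rationals [q > x], enumerated by [unpickle]. *)
  pose F i : set R := if choice.unpickle i is Some q then
     (if x < ratr q then `]ratr q, +oo[%classic else set0) else set0.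
  rewrite (_ : `]x, +oo[%classic = \bigcup_i F i).
    apply: Kcup => i; rewrite /F; case: (choice.unpickle i) => // q; case: ifPn => // _.
    split; first exact: measurable_itv.
    exact: (@approximable_step (GenTree.Leaf q)).
  apply/seteqP; split => y /=.
    rewrite in_itv/= andbT => xy; have [q] := rat_in_itvoo xy.
    rewrite in_itv/= => /andP[xq qy]; exists (choice.pickle q); first exact: I.
    by rewrite /F choice.pickleK xq; rewrite /= in_itv/= qy.
  move=> [i _]; rewrite /F; case: (choice.unpickle i) => // q; case: ifPn => // xq.
  by rewrite /= !in_itv/= !andbT; exact: lt_trans.
move=> mA; suff [] : K A by [].
have : (@RGenOInfty.G R).-sigma.-measurable A by rewrite -RGenOInfty.measurableE.
apply: smallest_sub => //; split => //.
by move=> B KB; rewrite setTD; exact: KC.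
Qed.

End density.
End step_functions.

(** * Duality over countably many test functions *)

Section countable_fenchel.
Context (R : realType).

(** The sum counts the integers in [[1, y]], hence is the integer part of [y]. *)
Lemma sum_threshold (N : nat) (y : R) : 0 <= y <= N%:R ->
  \sum_(k < N) (k.+1%:R <= y)%R%:R <= y <= \sum_(k < N) (k.+1%:R <= y)%R%:R + 1.
Proof.
elim: N => [|N IH] /andP[y0 yN]; first by rewrite big_ord0 y0 add0r (le_trans yN)// ler01.
rewrite big_ord_recr/=; have [yN'|Ny] := leP y N%:R.
  rewrite [in X in X%:R]leNgt (le_lt_trans yN') ?ltr_nat// addr0.
  by apply: IH; rewrite y0.
rewrite (eq_bigr (fun=> 1)) => [|k _]; last first.
  by rewrite (le_trans _ (ltW Ny))// ler_nat.
rewrite sumr_const card_ord.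
have [Ny'|yN'] := leP N.+1%:R y; last by rewrite addr0 (ltW Ny) natr1 (ltW yN').
by rewrite natr1 Ny' (le_trans yN)// lerDl.
Qed.

Lemma approximable_bounded (mu : {measure set R -> \bar R}) (g : R -> R) (M : R) :
  (mu setT < +oo)%E -> measurable_fun setT g -> (forall x, 0 <= g x <= M) ->
  approximable mu g.
Proof.
move=> mu_fin mg g0M.
have mset y : measurable [set x | y <= g x].
  rewrite (_ : [set x | y <= g x] = setT `&` g @^-1` `[y, +oo[).
    by apply: mg; [exact: measurableT|exact: measurable_itv].
  by apply/seteqP; split => x /=; rewrite in_itv/= andbT// => -[].
have mI (A : set R) : measurable A -> measurable_fun setT (\1_A : R -> R).
  by move=> mA; apply/measurable_indicP.
apply: (approximable_closed mg) => e e0.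
have muT : mu setT \is a fin_num by rewrite ge0_fin_numE.
pose m := fine (mu setT); have m0 : 0 <= m by exact: fine_ge0.
(* The grid width [1 / (n + 1)] times the total mass [m] is below [e]; [S] rounds [(n + 1) g] down
   to an integer. *)
pose n := Num.bound (m / e).
have hn : m / e < n.+1%:R.
  by rewrite (lt_trans (archi_boundP _))// ?ltr_nat// divr_ge0// ltW.
pose N := Num.bound (n.+1%:R * `|M|).
pose S x : R := \sum_(k < N) \1_[set x | k.+1%:R <= n.+1%:R * g x] x.
have mk y : measurable [set x | y <= n.+1%:R * g x].
  rewrite (_ : [set x | _] = [set x | n.+1%:R^-1 * y <= g x]); first exact: mset.
  by apply/seteqP; split => x /=; rewrite ler_pdivrMl.
have mS : measurable_fun setT S.
  by apply: measurable_sum => k; exact: (mI _ (mk _)).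
exists (fun x => n.+1%:R^-1 * S x).
  split; first exact: measurable_funM.
  apply: approximableV => //; rewrite /S.
  elim: (N) => [|N' IH].
    rewrite (_ : (fun x => _) = fun=> 0); first exact: approximable0.
    by apply/funext => x; rewrite big_ord0.
  rewrite (_ : (fun x => _) = fun x =>
    (\sum_(k < N') \1_[set x | k.+1%:R <= n.+1%:R * g x] x) +
    \1_[set x | N'.+1%:R <= n.+1%:R * g x] x); last first.
    by apply/funext => x; rewrite big_ord_recr.
  have mS' : measurable_fun setT (fun x => \sum_(k < N') \1_[set x | k.+1%:R <= n.+1%:R * g x] x : R).
    by apply: measurable_sum => k; exact: (mI _ (mk _)).
  exact: (approximableD mS' (mI _ (mk _)) IH (approximable_indic mu_fin (mk _))).
apply: (@le_trans _ _ (\int[mu]_x (n.+1%:R^-1)%:E)%E).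
  apply: ge0_le_integral_lower => x; rewrite lee_fin//.
  have -> : g x - n.+1%:R^-1 * S x = n.+1%:R^-1 * (n.+1%:R * g x - S x).
    by rewrite mulrBr mulKf.
  rewrite normrM ger0_norm// ler_piMr// ler_norml.
  have SE : S x = \sum_(k < N) (k.+1%:R <= n.+1%:R * g x)%R%:R.
    apply: eq_bigr => k _; rewrite indicE; congr ((nat_of_bool _)%:R).
    by apply/idP/idP => [/set_mem|h]//; exact/mem_set.
  have /andP[g0 gM] := g0M x.
  have := @sum_threshold N (n.+1%:R * g x); rewrite -SE mulr_ge0//=.
  have -> : n.+1%:R * g x <= N%:R.
    rewrite (le_trans _ (ltW (archi_boundP _)))// ler_pM2l//.
    exact: le_trans gM (ler_norm _).
  move=> /(_ isT)/andP[h1 h2]; rewrite lerBlDl h2 andbT.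
  by rewrite (@le_trans _ _ 0)// ?subr_ge0// oppr_le0.
rewrite integral_cst// -(fineK muT) -EFinM lee_fin -/m.
by rewrite ler_pdivrMl// -ler_pdivrMr// ltW.
Qed.

(** The exponential lies above its tangent at [s], whose slope is at most [expR N]. *)
Lemma expR_lipschitz (N s t : R) : s <= N -> expR s <= expR t + expR N * `|s - t|.
Proof.
move=> sN; have h : expR s * (1 + (t - s)) <= expR t.
  have -> : expR t = expR s * expR (t - s) by rewrite -expRD addrC subrK.
  by rewrite ler_pM2l ?expR_gt0// expR_ge1Dx.
have h1 : expR s * `|s - t| <= expR N * `|s - t| by rewrite ler_wpM2r// ler_expR.
have h2 : expR s * (s - t) <= expR s * `|s - t| by rewrite ler_wpM2l ?expR_ge0// ler_norm.
lra.
Qed.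

Definition nat_code (n : nat) : GenTree.tree rat :=
  iter n (fun c => GenTree.Node 0 [:: GenTree.Node 2 [::]; c]) (GenTree.Node 0 [::]).

Lemma step_fun_nat_code n x : step_fun (nat_code n) x = n%:R :> R.
Proof. by elim: n => //= n ->; rewrite nat1r. Qed.

(* [min(c, n) = (c - (c - n)^+)^+] *)
Definition min_code (n : nat) (c : GenTree.tree rat) : GenTree.tree rat :=
  GenTree.Node 1 [:: c; GenTree.Node 1 [:: c; nat_code n]].

Lemma step_fun_min_code n c x :
  step_fun (min_code n c) x = Num.min (step_fun c x) n%:R :> R.
Proof.
rewrite /= step_fun_nat_code; have c0 := step_fun_ge0 c x.
have n0 : 0 <= n%:R :> R by [].
have [cn|nc] := leP (step_fun c x) n%:R.
  by rewrite [X in _ - X]max_r ?subr_le0// subr0 max_l.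
by rewrite [X in _ - X]max_l ?subr_ge0 ?ltW// subKr max_l.
Qed.

(** L1 closeness alone does not control exponential moments; truncating the approximants at a bound
    [N] of the test function makes the exponential Lipschitz on their values. *)
Lemma fenchel_countable (P Q : probability R R) (C : \bar R) :
  (forall c n, \int[P]_x (step_fun c x)%:E + 1 <=
     C + n%:R%:E + (expR (- n%:R))%:E * \int[Q]_x (expR (step_fun c x))%:E)%E ->
  fenchel_bound P Q C.
Proof.
move=> PQ g M a mg g0M a0.
case: C PQ => [C| |] PQ; last 2 first.
- have [e _ ->] := bounded_integral_expRE Q mg g0M.
  by rewrite -EFinM addye// leey.
- exfalso; have := PQ (nat_code 0) 0%N.
  under eq_integral do rewrite step_fun_nat_code.
  under [X in (_ * X)%E]eq_integral do rewrite step_fun_nat_code.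
  by rewrite !integral_cst_probability -EFinM -EFinD.
(* The shift by [n - a] trades the real parameter [a] for an integer. *)
pose n := Num.bound a; have an : a <= n%:R by exact/ltW/archi_boundP.
pose h x := g x + (n%:R - a).
have mh : measurable_fun setT h by exact: measurable_funD.
pose N := Num.bound (`|M| + n%:R).
have h0N x : 0 <= h x <= N%:R.
  have /andP[g0 gM] := g0M x; rewrite addr_ge0 ?subr_ge0//=.
  rewrite (le_trans _ (ltW (archi_boundP _)))// ?addr_ge0//.
  by rewrite lerD// ?(le_trans gM (ler_norm _))// gerBl.
have g0 x : 0 <= g x by have /andP[] := g0M x.
have h0 x : 0 <= h x by have /andP[] := h0N x.
have hN x : h x <= N%:R by have /andP[] := h0N x.
have [p _ pE] := bounded_integralE P mg g0M.
have [q _ qE] := bounded_integral_expRE Q mg g0M.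
rewrite pE qE.
have -> : (p%:E = \int[P]_x (h x)%:E - (n%:R - a)%:E)%E.
  by rewrite ge0_integralD_EFin ?subr_ge0// integral_cst_probability pE -EFinB addrK.
have hexp : (\int[Q]_x (expR (h x))%:E = (expR (n%:R - a) * q)%:E)%E.
  under eq_integral do rewrite /h expRD mulrC.
  by rewrite ge0_integralZ_EFin ?expR_ge0 ?qE//; exact: measurable_expR_comp.
have [p' _ p'E] := bounded_integralE P mh h0N.
suff key : forall e : R, 0 < e ->
    p' + 1 <= C + n%:R + expR (- n%:R) * (expR (n%:R - a) * q + expR N%:R * e) + e.
  have : p' + 1 <= C + n%:R + expR (- n%:R) * (expR (n%:R - a) * q).
    apply/ler_addgt0Pr => e e0.
    (* Rescaled so that the two error terms of [key] add up to [e]. *)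
    pose e' := e / (expR (- n%:R) * expR N%:R + 1).
    have d0 : 0 < expR (- n%:R) * expR N%:R + 1 :> R.
      by rewrite ltr_wpDl// mulr_ge0// expR_ge0.
    have e'0 : 0 < e' by rewrite divr_gt0.
    have := key _ e'0.
    have -> : e = e' * (expR (- n%:R) * expR N%:R + 1) by rewrite divfK// gt_eqF.
    by lra.
  rewrite mulrA -expRD (_ : - n%:R + (n%:R - a) = - a); last by lra.
  by rewrite p'E -EFinM -EFinB -!EFinD lee_fin; lra.
move=> e e0.
(* A single code has to approximate [h] under both laws, hence in L1 of their sum. *)
pose nu := measure_add P Q.
have nuT : (nu setT < +oo)%E.
  have PT : (P : {measure set R -> \bar R}) setT = 1%E := probability_setT P.
  have QT : (Q : {measure set R -> \bar R}) setT = 1%E := probability_setT Q.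
  by rewrite /nu measure_addE PT QT -EFinD ltry.
have [c hc] := approximable_bounded nuT mh h0N e0.
have := PQ (min_code N c) n.
have mc := measurable_step_fun (R := R) (min_code N c).
have c0N (x : R) : 0 <= step_fun (min_code N c) x <= N%:R.
  by rewrite step_fun_ge0 step_fun_min_code ge_min lexx orbT.
(* As [h <= N], truncation at [N] does not increase the distance to [h]. *)
have hsc x : `|h x - step_fun (min_code N c) x| <= `|h x - step_fun c x|.
  rewrite step_fun_min_code; have [//|Nc] := leP (step_fun c x) N%:R.
  rewrite ler0_norm ?subr_le0// opprB ler0_norm ?opprB ?lerB ?(ltW Nc)//.
  by rewrite subr_le0 (le_trans (hN x))// ltW.
move: mc c0N hsc; move: (step_fun (min_code N c)) => sc mc c0N hsc PQc.
have sc0 x : 0 <= sc x by have /andP[] := c0N x.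
have md : measurable_fun setT (fun x => `|h x - sc x|).
  by apply: measurableT_comp => //; exact: measurable_funB.
have {}hc : (\int[nu]_x `|h x - sc x|%:E <= e%:E)%E.
  by apply: le_trans hc; apply: ge0_le_integral_lower => x; rewrite lee_fin.
move: hc; rewrite ge0_integral_measure_add//; last exact/measurable_EFinP.
have d0N x : 0 <= `|h x - sc x| <= N%:R + N%:R.
  have /andP[sx0 sxN] := c0N x.
  by rewrite normr_ge0/= (le_trans (ler_normB _ _))// !ger0_norm// lerD.
have [r1 /andP[r10 _] r1E] := bounded_integralE P md d0N.
have [r2 /andP[r20 _] r2E] := bounded_integralE Q md d0N.
rewrite r1E r2E -EFinD lee_fin => r12.
have [s _ sE] := bounded_integralE P mc c0N.
have [t _ tE] := bounded_integral_expRE Q mc c0N.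
rewrite sE tE -EFinM -!EFinD lee_fin in PQc.
have ps : p' <= s + r1.
  rewrite -lee_fin EFinD -sE -r1E -p'E -ge0_integralD_EFin//.
  apply: ge0_le_integral_lower => x; rewrite lee_fin//.
  by rewrite -lerBlDl ler_norm.
have tq : t <= expR (n%:R - a) * q + expR N%:R * r2.
  rewrite -lee_fin EFinD -hexp -tE EFinM -r2E.
  rewrite -(ge0_integralZ_EFin _ _ md) ?expR_ge0//.
  rewrite -ge0_integralD_EFin; last 4 first.
  - exact: measurable_expR_comp.
  - exact: measurable_funM.
  - by move=> x; rewrite expR_ge0.
  - by move=> x; rewrite mulr_ge0// expR_ge0.
  apply: ge0_le_integral_lower => x; rewrite lee_fin ?expR_ge0// distrC.
  by apply: expR_lipschitz; have /andP[] := c0N x.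
have tq' : t <= expR (n%:R - a) * q + expR N%:R * e.
  by rewrite (le_trans tq)// lerD2l ler_pM2l ?expR_gt0//; lra.
have := ler_wpM2l (expR_ge0 (- n%:R)) tq'; lra.
Qed.

(** A measurable substitute for [KL (k h) (l h)]: the last two clauses place [m] above this
    divergence and below any constant that passes the countably many dual tests. *)
Lemma countable_fenchelP (d : measure_display) (H : measurableType d)
    (k l : R.-pker H ~> R) :
  exists m : H -> \bar R, [/\ measurable_fun setT m, (forall h, 0 <= m h)%E,
    (forall h, fenchel_bound (k h) (l h) (m h)) &
    forall h (C : \bar R), (forall c n, \int[k h]_x (step_fun c x)%:E + 1 <=
      C + n%:R%:E + (expR (- n%:R))%:E * \int[l h]_x (expR (step_fun c x))%:E)%E ->
    (m h <= C)%E].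
Proof.
pose V (c : GenTree.tree rat) (n : nat) h := (\int[k h]_x (step_fun c x)%:E + 1
  - (n%:R%:E + (expR (- n%:R))%:E * \int[l h]_x (expR (step_fun c x))%:E))%E.
(* Undecodable indices get 0, which is also the value of [V] at the zero code and [n = 0], so the
   supremum is unaffected. *)
pose U (i : nat) := if choice.unpickle i is Some (c, n) then V c n else cst 0%E.
pose m h := ereal_sup [set U i h | i in setT].
have intE h c : exists r s : R, (\int[k h]_x (step_fun c x)%:E)%E = r%:E /\
    (\int[l h]_x (expR (step_fun c x))%:E)%E = s%:E.
  have [mc [M cM]] := step_funP R c.
  have [r _ rE] := bounded_integralE (probability_of (prob_kernel (s := k) h)) mc cM.
  have [s _ sE] := bounded_integral_expRE (probability_of (prob_kernel (s := l) h)) mc cM.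
  by exists r, s.
have VE h c n C : (V c n h <= C)%E = (\int[k h]_x (step_fun c x)%:E + 1 <=
     C + n%:R%:E + (expR (- n%:R))%:E * \int[l h]_x (expR (step_fun c x))%:E)%E.
  have [r [s [rE sE]]] := intE h c.
  by rewrite /V rE sE -EFinM leeBlDr ?addeA.
have m_ub h c n : (V c n h <= m h)%E.
  apply: ereal_sup_ubound; exists (choice.pickle (c, n)); first exact: I.
  by rewrite /U choice.pickleK.
have mU i : measurable_fun setT (U i).
  rewrite /U; case: (choice.unpickle i) => [[c n]|]; last exact: measurable_cst.
  have mc := measurable_step_fun (R := R) c.
  apply: emeasurable_funB.
    apply: emeasurable_funD => //.
    apply: measurable_fun_integral_kernel.
    - by move=> A mA; exact: measurable_kernel.
    - by move=> x; rewrite lee_fin step_fun_ge0.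
    - exact/measurable_EFinP.
  apply: emeasurable_funD => //; apply: measurable_funeM.
  apply: measurable_fun_integral_kernel.
  - by move=> A mA; exact: measurable_kernel.
  - by move=> x; rewrite lee_fin expR_ge0.
  - exact/measurable_EFinP/measurable_expR_comp.
exists m; split.
- have -> : m = fun h => esups (U ^~ h) 0%N.
    apply/funext => h; rewrite /m /esups /=; congr ereal_sup.
    by apply/seteqP; split => x [i ? <-]; exists i.
  exact: measurable_fun_esups.
- move=> h; apply: le_trans (m_ub h (nat_code 0) 0%N).
  rewrite /V; under eq_integral do rewrite step_fun_nat_code.
  under [X in (_ * X)%E]eq_integral do rewrite step_fun_nat_code.
  rewrite (integral_cst_probability (probability_of (prob_kernel (s := k) h))).
  rewrite (integral_cst_probability (probability_of (prob_kernel (s := l) h))).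
  by rewrite oppr0 !expR0 mul1e !add0e subee.
- move=> h.
  apply: (@fenchel_countable (probability_of (prob_kernel (s := k) h))
    (probability_of (prob_kernel (s := l) h))) => c n.
  by rewrite -VE; exact: m_ub.
- move=> h C PQ; apply: ge_ereal_sup => _ [i _ <-]; rewrite /U.
  case: (choice.unpickle i) => [[c n]|]; first by rewrite VE.
  have := PQ (nat_code 0) 0%N; rewrite -VE; apply: le_trans.
  rewrite /V; under eq_integral do rewrite step_fun_nat_code.
  under [X in (_ * X)%E]eq_integral do rewrite step_fun_nat_code.
  rewrite (integral_cst_probability (probability_of (prob_kernel (s := k) h))).
  rewrite (integral_cst_probability (probability_of (prob_kernel (s := l) h))).
  by rewrite oppr0 !expR0 mul1e !add0e subee.
Qed.

End countable_fenchel.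

(** * Autoregressive laws *)

Section autoregressive.
Local Open Scope ereal_scope.
Context d (HT : measurableType d) (R : realType).
Implicit Types (q : forall s : nat, R.-pker (HT * s.-tuple R)%type ~> R) (h : HT).

Lemma measurable_rcons_tuple n :
  measurable_fun setT (fun z : (HT * n.-tuple R) * R => rcons_tuple z.1.2 z.2).
Proof.
apply/measurable_fun_tnthP => i /=.
have [ni|] := ltnP i n.
  rewrite (_ : _ \o _ = fun z : (HT * n.-tuple R) * R => tnth z.1.2 (Ordinal ni)); last first.
    apply/funext => z /=; rewrite !(tnth_nth 0%R)/= nth_rcons size_tuple ni//.
  apply: (measurableT_comp (measurable_tnth (Ordinal ni))) => //.
  exact: (measurableT_comp measurable_snd measurable_fst).
move=> ni; rewrite (_ : _ \o _ = snd); first exact: measurable_snd.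
apply/funext => z /=; rewrite (tnth_nth 0%R)/= nth_rcons size_tuple ltnNge ni/=.
by rewrite eqn_leq ni -ltnS (ltn_ord i).
Qed.

Lemma arint_congr q h (f g : seq R -> \bar R) k n (p : n.-tuple R) :
  (forall s, size s = (k + n)%N -> f s = g s) ->
  arint q h f k p = arint q h g k p.
Proof.
elim: k n p => [|k IH] n p fg /=; first by apply: fg; rewrite size_tuple.
by apply: eq_integral => y _; apply: IH => s sE; apply: fg; rewrite sE addnS.
Qed.

Lemma arint_ge0 q h (f : seq R -> \bar R) k n (p : n.-tuple R) :
  (forall s, 0 <= f s) -> 0 <= arint q h f k p.
Proof.
move=> f0; elim: k n p => [|k IH] n p /=; first exact: f0.
by apply: integral_ge0 => y _; exact: IH.
Qed.

Lemma measurable_arint q h N (f : seq R -> \bar R) :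
  (forall s, 0 <= f s) -> measurable_fun setT (fun p : N.-tuple R => f p) ->
  forall k n, (k + n)%N = N -> measurable_fun setT (fun p : n.-tuple R => arint q h f k p).
Proof.
move=> f0 mf; elim=> [|k IH] n /=; first by rewrite add0n => ->.
rewrite addSnnS => /IH mk.
pose A (z : (HT * n.-tuple R) * R) := arint q h f k (rcons_tuple z.1.2 z.2).
have mA : measurable_fun setT A := measurableT_comp mk (@measurable_rcons_tuple n).
have A0 z : 0 <= A z by exact: arint_ge0.
have mI := measurable_fun_integral_sfinite_kernel A (q n) A0 mA.
exact: (measurableT_comp mI (measurable_pair1 h)).
Qed.

Lemma measurable_arint_rcons q h N (f : seq R -> \bar R) k n (p : n.-tuple R) :
  (forall s, 0 <= f s) -> measurable_fun setT (fun p : N.-tuple R => f p) ->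
  (k + n.+1)%N = N -> measurable_fun setT (fun y => arint q h f k (rcons_tuple p y)).
Proof.
move=> f0 mf kn; have mk := measurable_arint q h f0 mf kn.
have mr := measurableT_comp (@measurable_rcons_tuple n) (measurable_pair1 (h, p)).
exact: (measurableT_comp mk mr).
Qed.

Lemma arintD q h N (f g : seq R -> \bar R) :
  (forall s, 0 <= f s) -> measurable_fun setT (fun p : N.-tuple R => f p) ->
  (forall s, 0 <= g s) -> measurable_fun setT (fun p : N.-tuple R => g p) ->
  forall k n (p : n.-tuple R), (k + n)%N = N ->
  arint q h (fun s => f s + g s) k p = arint q h f k p + arint q h g k p.
Proof.
move=> f0 mf g0 mg; elim=> [//|k IH] n p; rewrite addSnnS => kn /=.
rewrite -ge0_integralD//.
- by apply: eq_integral => y _; rewrite IH.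
- by move=> y _; exact: arint_ge0.
- exact: measurable_arint_rcons mf kn.
- by move=> y _; exact: arint_ge0.
- exact: measurable_arint_rcons mg kn.
Qed.

Lemma arintZ q h N (c : R) (f : seq R -> \bar R) : (0 <= c)%R ->
  (forall s, 0 <= f s) -> measurable_fun setT (fun p : N.-tuple R => f p) ->
  forall k n (p : n.-tuple R), (k + n)%N = N ->
  arint q h (fun s => c%:E * f s) k p = c%:E * arint q h f k p.
Proof.
move=> c0 f0 mf; elim=> [//|k IH] n p; rewrite addSnnS => kn /=.
rewrite -ge0_integralZl//.
- by apply: eq_integral => y _; rewrite IH.
- exact: measurable_arint_rcons mf kn.
- by move=> y _; exact: arint_ge0.
Qed.

Lemma arint_nondecreasing q h (f_ : nat -> seq R -> \bar R) :
  (forall n s, 0 <= f_ n s) -> (forall s, nondecreasing_seq (f_ ^~ s)) ->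
  forall k n (p : n.-tuple R), nondecreasing_seq (fun i => arint q h (f_ i) k p).
Proof.
move=> f0 ndf; elim=> [|k IH] n p i j ij /=; first exact: ndf.
apply: ge0_le_integral_lower => y; first exact: arint_ge0.
exact: IH.
Qed.

Lemma arint_lim q h N (f_ : nat -> seq R -> \bar R) :
  (forall n s, 0 <= f_ n s) ->
  (forall n, measurable_fun setT (fun p : N.-tuple R => f_ n p)) ->
  (forall s, nondecreasing_seq (f_ ^~ s)) ->
  forall k n (p : n.-tuple R), (k + n)%N = N ->
  arint q h (fun s => limn (f_ ^~ s)) k p = limn (fun i => arint q h (f_ i) k p).
Proof.
move=> f0 mf ndf; elim=> [//|k IH] n p; rewrite addSnnS => kn /=.
rewrite -monotone_convergence//.
- by apply: eq_integral => y _; rewrite IH.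
- by move=> i; exact: measurable_arint_rcons (mf i) kn.
- by move=> i y _; exact: arint_ge0.
- by move=> y _; exact: (arint_nondecreasing q h).
Qed.

Lemma measurable_reorder T (sigma : {perm 'I_T}) :
  measurable_fun setT (fun p : T.-tuple R => reorder sigma p).
Proof.
apply/measurable_fun_tnthP => i /=.
rewrite (_ : _ \o _ = fun p : T.-tuple R => tnth p ((sigma^-1)%g i)).
  exact: measurable_tnth.
by apply/funext => p /=; rewrite tnth_mktuple (tnth_nth 0%R).
Qed.

Lemma integral_arint q h T (sigma : {perm 'I_T}) (Q : {measure set (T.-tuple R) -> \bar R}) :
  (forall A, measurable A ->
     Q A = arint q h (fun g => (\1_A (reorder sigma g))%:E) T [tuple]) ->
  forall F : T.-tuple R -> \bar R, measurable_fun setT F -> (forall x, 0 <= F x) ->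
  \int[Q]_x F x = arint q h (fun g => F (reorder sigma g)) T [tuple].
Proof.
move=> QE F mF F0; apply/esym.
have TE : (T + 0)%N = T by rewrite addn0.
have mr (u : T.-tuple R -> \bar R) : measurable_fun setT u ->
    measurable_fun setT (fun p : T.-tuple R => u (reorder sigma p)).
  by move=> mu; exact: (measurableT_comp mu (measurable_reorder sigma)).
apply: (functionalE (Phi := fun u => arint q h (fun g => u (reorder sigma g)) T [tuple])) => //.
- by move=> A mA; rewrite QE.
- move=> c u c0 mu u0.
  exact: (@arintZ q h T c (fun g => u (reorder sigma g)) c0 (fun=> u0 _) (mr _ mu) T 0 [tuple] TE).
- move=> u v mu u0 mv v0.
  exact: (@arintD q h T (fun g => u (reorder sigma g)) (fun g => v (reorder sigma g))
    (fun=> u0 _) (mr _ mu) (fun=> v0 _) (mr _ mv) T 0 [tuple] TE).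
- move=> u_ mu u0 ndu.
  exact: (@arint_lim q h T (fun n g => u_ n (reorder sigma g)) (fun _ _ => u0 _ _)
    (fun n => mr _ (mu n)) (fun=> ndu _) T 0 [tuple] TE).
Qed.

(** Types the bare sequences that [arint] passes to its integrand; on a sequence longer than [m] it
    returns the prefix of length [m]. *)
Definition resize m (s : seq R) : m.-tuple R := [tuple nth 0%R s i | i < m].

Lemma resize_id m (p : m.-tuple R) : resize m p = p.
Proof. by apply: eq_from_tnth => i; rewrite tnth_mktuple (tnth_nth 0%R). Qed.

Lemma resize_rcons m (s : seq R) y : size s = m ->
  resize m.+1 (rcons s y) = rcons_tuple (resize m s) y.
Proof.
move=> sm; apply: eq_from_tnth => i; rewrite tnth_mktuple (tnth_nth 0%R).
rewrite [in RHS]nth_rcons nth_rcons size_tuple sm; case: ltnP => // im.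
by rewrite -[i : nat]/(nat_of_ord (Ordinal im)) -tnth_nth tnth_mktuple.
Qed.

(** [arint] unfolds from the first generated coordinate; disintegrating the prefix laws requires
    peeling off the last one. *)
Lemma arint_last q h (f : seq R -> \bar R) k n (p : n.-tuple R) :
  arint q h f k.+1 p = arint q h (fun g =>
     \int[q (k + n)%N (h, resize (k + n) g)]_y f (rcons g y)) k p.
Proof.
elim: k n p => [|k IH] n p.
  by rewrite /= add0n resize_id.
rewrite [RHS]/= [LHS]/=; apply: eq_integral => y _.
by have := IH n.+1 (rcons_tuple p y); rewrite /= addnS.
Qed.

Lemma gen_prefix_reorder T (sigma : {perm 'I_T}) (g : seq R) s : (s <= T)%N ->
  gen_prefix sigma (reorder sigma g) s = resize s g.
Proof.
move=> sT; apply: eq_from_tnth => i; rewrite !tnth_mktuple.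
have iT : (i < T)%N by exact: leq_trans (ltn_ord i) sT.
rewrite (nth_map (Ordinal iT)) ?size_enum_ord// tnth_mktuple.
by rewrite permK nth_enum_ord.
Qed.

Lemma reorder_gen_prefix T (sigma : {perm 'I_T}) (x : T.-tuple R) :
  reorder sigma (gen_prefix sigma x T) = x.
Proof.
apply: eq_from_tnth => i; rewrite tnth_mktuple -tnth_nth tnth_mktuple.
rewrite (nth_map i) ?size_enum_ord//.
by rewrite nth_ord_enum permKV.
Qed.

Lemma measurable_gen_prefix T (sigma : {perm 'I_T}) s :
  measurable_fun setT (fun x : T.-tuple R => gen_prefix sigma x s).
Proof.
apply/measurable_fun_tnthP => i /=.
have [iT|Ti] := ltnP i T.
  rewrite (_ : _ \o _ = fun x : T.-tuple R => tnth x (sigma (Ordinal iT))).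
    exact: measurable_tnth.
  apply/funext => x /=; rewrite tnth_mktuple (nth_map (Ordinal iT)) ?size_enum_ord//.
  by congr (tnth _ (sigma _)); apply: val_inj; rewrite /= nth_enum_ord.
rewrite (_ : _ \o _ = cst 0%R); first exact: measurable_cst.
by apply/funext => x /=; rewrite tnth_mktuple nth_default// size_map size_enum_ord.
Qed.

Section law.
Context q h T (sigma : {perm 'I_T}) (Q : {measure set (T.-tuple R) -> \bar R}).
Hypothesis QE : forall A, measurable A ->
  Q A = arint q h (fun g => (\1_A (reorder sigma g))%:E) T [tuple].

(** The coordinates generated after the prefix integrate out because each kernel has mass 1. *)
Lemma arint_resize s m (u : s.-tuple R -> \bar R) : (s <= m)%N ->
  arint q h (fun g => u (resize s g)) m [tuple] =
  arint q h (fun g => u (resize s g)) s [tuple].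
Proof.
elim: m => [|m IH]; first by rewrite leqn0 => /eqP sm; subst s.
rewrite leq_eqVlt => /predU1P[sE|]; [by subst s|rewrite ltnS => sm].
rewrite -IH// arint_last; apply: arint_congr => g; rewrite addn0 => gm.
rewrite (_ : (fun y => _) = cst (u (resize s g))).
  by rewrite integral_cst//= prob_kernel mule1.
apply/funext => y; congr u; apply: eq_from_tnth => i; rewrite !tnth_mktuple.
by rewrite nth_rcons gm (leq_trans (ltn_ord i) sm).
Qed.

Lemma integral_gen_prefix s (u : s.-tuple R -> \bar R) : (s <= T)%N ->
  measurable_fun setT u -> (forall p, 0 <= u p) ->
  \int[Q]_x u (gen_prefix sigma x s) = arint q h (fun g => u (resize s g)) s [tuple].
Proof.
move=> sT mu u0.
have mF : measurable_fun setT (fun x : T.-tuple R => u (gen_prefix sigma x s)).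
  have mg := @measurable_gen_prefix T sigma s.
  by have := measurableT_comp mu mg.
rewrite (integral_arint QE mF)//.
rewrite -(arint_resize u sT); apply: arint_congr => g _.
by rewrite gen_prefix_reorder.
Qed.

Lemma integral_gen_prefixS s (u : s.+1.-tuple R -> \bar R) : (s < T)%N ->
  measurable_fun setT u -> (forall p, 0 <= u p) ->
  \int[Q]_x u (gen_prefix sigma x s.+1) =
  \int[Q]_x \int[q s (h, gen_prefix sigma x s)]_y u (rcons_tuple (gen_prefix sigma x s) y).
Proof.
move=> sT mu u0; rewrite integral_gen_prefix//.
pose v (p : s.-tuple R) := \int[q s (h, p)]_y u (rcons_tuple p y).
rewrite (integral_gen_prefix (u := v))//; last 3 first.
- exact: ltnW.
- pose A (z : (HT * s.-tuple R) * R) := u (rcons_tuple z.1.2 z.2).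
  have mA : measurable_fun setT A := measurableT_comp mu (@measurable_rcons_tuple s).
  have A0 z : 0 <= A z by exact: u0.
  have mI := measurable_fun_integral_sfinite_kernel A (q s) A0 mA.
  exact: (measurableT_comp mI (measurable_pair1 h)).
- by move=> p; apply: integral_ge0.
rewrite arint_last; apply: arint_congr => g; rewrite addn0 => gs.
by apply: eq_integral => y _; rewrite resize_rcons.
Qed.

End law.
End autoregressive.

(** [expR x >= 1 + x] at [x = w - a]; it turns a log-moment [w] back into the form with [a] free. *)
Lemma add1_le_expR (R : realType) (w a : R) : w + 1 <= a + expR (- a) * expR w.
Proof. by have := expR_ge1Dx (w - a); rewrite -expRD (addrC (- a)); lra. Qed.

(** * The chain rule along the generation order *)

Section chain.
Local Open Scope ereal_scope.
Context d (HT : measurableType d) (R : realType).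
Context (qs qt : forall s : nat, R.-pker (HT * s.-tuple R)%type ~> R) (h : HT).
Context (T : nat) (sigma : {perm 'I_T}) (Qs Qt : {measure set (T.-tuple R) -> \bar R}).
Hypothesis QsE : forall A, measurable A ->
  Qs A = arint qs h (fun g => (\1_A (reorder sigma g))%:E) T [tuple].
Hypothesis QtE : forall A, measurable A ->
  Qt A = arint qt h (fun g => (\1_A (reorder sigma g))%:E) T [tuple].
Hypothesis Qs1 : Qs setT = 1.

Let kl s (p : s.-tuple R) := KL (qs s (h, p)) (qt s (h, p)).

Let kl_ge0 s (p : s.-tuple R) : 0 <= kl p.
Proof.
exact: (KL_ge0 (probability_of (prob_kernel (s := qs s) (h, p)))
  (probability_of (prob_kernel (s := qt s) (h, p)))).
Qed.

(* [psi k p] is the log-moment of [G] under the learned law once the prefix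
   [p] is generated and [k] coordinates remain: telescoping it along the
   generation is the chain rule for the Donsker-Varadhan functional. *)
Lemma fenchel_autoregressive :
  fenchel_bound Qs Qt (\sum_(0 <= s < T) \int[Qs]_x kl (gen_prefix sigma x s)).
Proof.
move=> G M a mG G0M a0.
have G0 x : (0 <= G x)%R by have /andP[] := G0M x.
have GM x : (G x <= M)%R by have /andP[] := G0M x.
pose f (g : seq R) := (expR (G (reorder sigma g)))%:E.
have f0 g : 0 <= f g by rewrite lee_fin expR_ge0.
have mf : measurable_fun setT (fun p : T.-tuple R => f p).
  apply/measurable_EFinP; apply: measurable_expR_comp.
  by have := measurableT_comp mG (measurable_reorder sigma).
pose W k n (p : n.-tuple R) := arint qt h f k p.
have WE k n (p : n.-tuple R) : exists2 w : R, (1 <= w <= expR M)%R & W k n p = w%:E.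
  have W1M : 1 <= W k n p <= (expR M)%:E.
    rewrite /W; elim: k n p => [|k IH] n p /=.
      by rewrite /f !lee_fin ler_expR GM andbT -expR0 ler_expR.
    rewrite -(integral_cst_probability (probability_of (prob_kernel (s := qt n) (h, p))) 1).
    rewrite -(integral_cst_probability (probability_of (prob_kernel (s := qt n) (h, p))) (expR M)).
    apply/andP; split; apply: ge0_le_integral_lower => y.
    - by rewrite lee_fin.
    - by have /andP[] := IH n.+1 (rcons_tuple p y).
    - exact: arint_ge0.
    - by have /andP[] := IH n.+1 (rcons_tuple p y).
  case: (W k n p) W1M => [w| |] /andP[w1 wM] //.
  by exists w => //; rewrite -!lee_fin w1.
pose psi k n (p : n.-tuple R) : R := ln (fine (W k n p)).
have psi0M : forall k n (p : n.-tuple R), (0 <= psi k n p <= M)%R.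
  move=> k n p.
  rewrite /psi; have [w /andP[w1 wM] ->] := WE k n p; rewrite ln_ge0//=.
  by rewrite -[leRHS]expRK ler_ln ?posrE ?expR_gt0// (lt_le_trans _ w1).
have psi0 : forall k n (p : n.-tuple R), (0 <= psi k n p)%R.
  by move=> k n p; have /andP[] := psi0M k n p.
have expsi : forall k n (p : n.-tuple R), (expR (psi k n p))%:E = W k n p.
  move=> k n p.
  rewrite /psi; have [w /andP[w1 wM] ->] := WE k n p.
  by rewrite lnK// posrE (lt_le_trans _ w1).
have mlf : measurable_fun setT (fun w : \bar R => ln (fine w)) by exact: measurableT_comp.
have mpsi k n : (k + n)%N = T -> measurable_fun setT (@psi k n).
  move=> kn; have mA := measurable_arint qt h f0 mf kn.
  by have := measurableT_comp mlf mA.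
have mpsi_rcons k n (p : n.-tuple R) : (k + n.+1)%N = T ->
    measurable_fun setT (fun y => psi k n.+1 (rcons_tuple p y)).
  move=> kn; have mA := @measurable_arint_rcons _ _ _ qt h _ f k n p f0 mf kn.
  by have := measurableT_comp mlf mA.
(* The dual inequality for one kernel, with [a = psi k.+1 n p] and [g] the value of [psi] at the
   extended prefix: by definition of [W] the exponential moment of [g] is [e^a], so the last term is
   1 and cancels the added 1. *)
have step k n (p : n.-tuple R) : (k + n.+1)%N = T ->
    \int[qs n (h, p)]_y (psi k n.+1 (rcons_tuple p y))%:E <= kl p + (psi k.+1 n p)%:E.
  move=> kn.
  have := @fenchel_KL _ _ _ (probability_of (prob_kernel (s := qs n) (h, p)))
    (probability_of (prob_kernel (s := qt n) (h, p))) _ M (psi k.+1 n p)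
    (mpsi_rcons k n p kn) (fun y => psi0M _ _ _) (psi0 _ _ _).
  under [X in _ <= _ + _ * X -> _]eq_integral do rewrite expsi.
  rewrite -[X in _ <= _ + _ * X -> _]/(W k.+1 n p) -expsi.
  by rewrite -EFinM -expRD addNr expR0 leeD2rE.
(* Downward from [n = T], where [psi] is [G] itself; each step trades the last coordinate for one
   conditional divergence. *)
have chain k n : (k + n)%N = T -> \int[Qs]_x (G x)%:E <=
    \sum_(n <= s < T) \int[Qs]_x kl (gen_prefix sigma x s) +
    \int[Qs]_x (psi k n (gen_prefix sigma x n))%:E.
  elim: k n => [|k IH] n.
    rewrite add0n => ->; rewrite big_geq// add0e.
    apply: ge0_le_integral_lower => x; rewrite lee_fin//.
    by rewrite /psi /W /= /f expRK reorder_gen_prefix.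
  rewrite addSnnS => kn; apply: (le_trans (IH _ kn)).
  have nT : (n < T)%N by rewrite -kn leq_addl.
  rewrite [in leRHS]big_ltn// [in leRHS]addeC addeA [in leRHS]addeC leeD2l//.
  have mk : measurable_fun setT (fun p => (psi k n.+1 p)%:E).
    by apply/measurable_EFinP; exact: mpsi.
  rewrite (integral_gen_prefixS QsE nT mk) => [|p]; last by rewrite lee_fin.
  (* A real-valued copy of the inner integral, for [le_integralD_lower]; there [kl], possibly
     nonmeasurable, is the function [g]. *)
  pose A (p : n.-tuple R) : R := fine (\int[qs n (h, p)]_y (psi k n.+1 (rcons_tuple p y))%:E).
  have AE p : (A p)%:E = \int[qs n (h, p)]_y (psi k n.+1 (rcons_tuple p y))%:E.
    have [r _ rE] := bounded_integralE (probability_of (prob_kernel (s := qs n) (h, p)))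
      (mpsi_rcons k n p kn) (fun y => psi0M _ _ _).
    by rewrite /A rE.
  under [leLHS]eq_integral do rewrite -AE.
  rewrite addeC; apply: le_integralD_lower.
  - have mg := @measurable_gen_prefix R T sigma n.
    have mA : measurable_fun setT A.
      apply: measurableT_comp => //.
      pose B (z : (HT * n.-tuple R) * R) := (psi k n.+1 (rcons_tuple z.1.2 z.2))%:E.
      have mB : measurable_fun setT B := measurableT_comp mk (@measurable_rcons_tuple _ HT R n).
      have B0 z : 0 <= B z by rewrite lee_fin.
      have mI := measurable_fun_integral_sfinite_kernel B (qs n) B0 mB.
      exact: (measurableT_comp mI (measurable_pair1 h)).
    by have := measurableT_comp mA mg.
  - have mg := @measurable_gen_prefix R T sigma n.
    have mp : measurable_fun setT (@psi k.+1 n) by apply: mpsi; rewrite addSnnS.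
    by have := measurableT_comp mp mg.
  - by move=> x; apply: fine_ge0; apply: integral_ge0 => y _; rewrite lee_fin.
  - by move=> x; exact: psi0.
  - by move=> x; exact: kl_ge0.
  - by move=> x; rewrite AE; exact: step.
have := chain T 0%N (addn0 T).
rewrite (_ : (fun x => (psi T 0%N (gen_prefix sigma x 0))%:E) =
  fun=> (psi T 0%N [tuple])%:E); last first.
  by apply/funext => x; congr (psi _ _ _)%:E; exact: tuple0.
rewrite (integral_cst_probability (probability_of Qs1)).
have -> : \int[Qt]_x (expR (G x))%:E = W T 0%N [tuple].
  have mE : measurable_fun setT (fun x => (expR (G x))%:E).
    exact/measurable_EFinP/measurable_expR_comp.
  by rewrite (integral_arint QtE mE)// => x; rewrite lee_fin expR_ge0.
rewrite -expsi => GE; apply: (le_trans (leeD2r 1 GE)).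
rewrite -[leLHS]addeA -[leRHS]addeA leeD2l// -EFinM -!EFinD lee_fin.
exact: add1_le_expR.
Qed.

End chain.

(** * Censored observations *)

Section disintegration.
Local Open Scope ereal_scope.

(** The hypothesis compares two measures on [H]: [eta] times the law of [f], and the law of [f]
    restricted to [D]. Such an inequality passes to integrals of nonnegative measurable
    functions. *)
Lemma ge0_le_integral_conditional d1 d2 (W : measurableType d1) (H : measurableType d2)
    (R : realType) (mu : {measure set W -> \bar R}) (f : W -> H) (D : set W) (eta : {nonneg R})
    (m : H -> \bar R) :
  measurable_fun setT f -> measurable D ->
  (forall S, measurable S -> eta%:num%:E * mu (f @^-1` S) <= mu (f @^-1` S `&` D)) ->
  measurable_fun setT m -> (forall h, 0 <= m h) ->
  eta%:num%:E * \int[mu]_w m (f w) <= \int[mu]_w (m (f w) * (\1_D w)%:E).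
Proof.
move=> mf mD etaD mm m0.
pose m1 : {measure set H -> \bar R} := mscale eta (measure_function_pushforward__canonical__measure_function_Measure mu mf).
pose m2 : {measure set H -> \bar R} := measure_function_pushforward__canonical__measure_function_Measure (mrestr mu mD) mf.
have mmf : measurable_fun setT (m \o f) by exact: measurableT_comp.
have <- : \int[m1]_h m h = eta%:num%:E * \int[mu]_w m (f w).
  rewrite ge0_integral_mscale//; congr (_ * _).
  by rewrite (ge0_integral_pushforward mf _ measurableT mm (fun h _ => m0 h)).
have <- : \int[m2]_h m h = \int[mu]_w (m (f w) * (\1_D w)%:E).
  rewrite (ge0_integral_pushforward mf _ measurableT mm (fun h _ => m0 h)) preimage_setT.
  rewrite (@ge0_integral_density_ereal _ _ _ _ mu (\1_D))//.
  split; first exact/measurable_indicP.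
    by move=> x.
    by move=> A mA; rewrite integral_indic// /mrestr setIC.
  by move=> x; exact: m0.
have m12 S : measurable S -> m1 S <= m2 S by exact: etaD.
exact: (ge0_le_measure_integral m12 measurableT m0 mm).
Qed.

End disintegration.

(** [ln (1 + x) <= x] at [x = - 1 / (n + 2)] gives [1 / (n + 2) <= ln (n + 2) - ln (n + 1)], which
    telescopes. The sum starts at [1 / 2], hence [ln n] without an added 1. *)
Lemma sum_harmonic_le_ln (R : realType) (n : nat) :
  \sum_(1 <= s < n) (s.+1%:R)^-1 <= ln n%:R :> R.
Proof.
elim: n => [|n IH]; first by rewrite big_geq// ln0.
case: n IH => [|n] IH; first by rewrite big_geq// ln1.
rewrite big_nat_recr//= (le_trans (lerD IH (lexx _)))// -lerBrDl.
have x1 : -1 < - (n.+2%:R)^-1 :> R by rewrite ltrN2 invf_lt1// ltr1n.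
have := le_ln1Dx x1.
have -> : 1 + - (n.+2%:R)^-1 = n.+1%:R / n.+2%:R :> R.
  by apply: (mulIf (x := n.+2%:R)); rewrite // mulrDl mul1r mulNr mulVf// divfK// -natr1 addrK.
by rewrite ln_div ?posrE// lerNr opprB.
Qed.

(** * Histories and observation laws in one round *)

Section observation.
Local Open Scope ereal_scope.
Context (R : realType).

Lemma measurable_psi (x : R) : measurable_fun setT (psi x).
Proof.
apply: measurable_fun_pair; first exact: measurable_minr.
exact: measurable_fun_ler.
Qed.

Lemma measurable_hist T (t : 'I_T) :
  measurable_fun setT (hist t : T.-tuple R * T.-tuple R -> Hist R t).
Proof.
apply/measurable_fun_tnthP => s.
pose i := widen_ord (ltnW (ltn_ord t)) s.
have m1 : measurable_fun setT (fun w : T.-tuple R * T.-tuple R => tnth w.1 i).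
  exact: (measurableT_comp (measurable_tnth i) measurable_fst).
have m2 : measurable_fun setT (fun w : T.-tuple R * T.-tuple R => tnth w.2 i).
  exact: (measurableT_comp (measurable_tnth i) measurable_snd).
rewrite (_ : _ \o _ = fun w : T.-tuple R * T.-tuple R =>
    (tnth w.2 i, (Num.min (tnth w.1 i) (tnth w.2 i), (tnth w.1 i <= tnth w.2 i)%R))).
  apply: measurable_fun_pair => //; apply: measurable_fun_pair.
    exact: measurable_minr.
  exact: measurable_fun_ler.
by apply/funext => w /=; rewrite tnth_mktuple.
Qed.

Section one_round.
Context d (HT : measurableType d) (qs qt : forall s : nat, R.-pker (HT * s.-tuple R)%type ~> R).
Context (h : HT) (T : nat) (sigma : {perm 'I_T}) (t : 'I_T) (B : R).
Hypothesis sigma0 : forall j : 'I_T, nat_of_ord j = 0%N -> sigma j = t.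

Lemma integral_tnth_arint q (Q : {measure set (T.-tuple R) -> \bar R}) (u : R -> \bar R) :
  (forall A, measurable A ->
    Q A = arint q h (fun g => (\1_A (reorder sigma g))%:E) T [tuple]) ->
  Q setT = 1 -> measurable_fun setT u -> (forall y, 0 <= u y) ->
  \int[Q]_x u (tnth x t) = \int[q 0%N (h, [tuple])]_y u y.
Proof.
move=> QE Q1 mu u0; have T0 : (0 < T)%N by exact: leq_trans (ltn_ord t).
pose v (p : 1.-tuple R) := u (tnth p ord0).
have mv : measurable_fun setT v.
  by have := measurableT_comp mu (@measurable_tnth _ _ 1 ord0).
have := integral_gen_prefixS QE T0 mv (fun p => u0 _).
have -> : (fun x => v (gen_prefix sigma x 1)) = fun x => u (tnth x t).
  apply/funext => x; rewrite /v tnth_mktuple (nth_map (Ordinal T0)) ?size_enum_ord//.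
  by rewrite sigma0// nth_enum_ord.
move=> ->; rewrite (_ : (fun x => _) = cst (\int[q 0%N (h, [tuple])]_y u y)).
  by rewrite integral_cst// Q1 mule1.
apply/funext => x /=; rewrite (tuple0 (gen_prefix sigma x 0)).
by apply: eq_integral => y _; rewrite /v (tnth_nth 0%R).
Qed.

Context (Qs Qt : {measure set (T.-tuple R) -> \bar R}).
Hypothesis QsE : forall A, measurable A ->
  Qs A = arint qs h (fun g => (\1_A (reorder sigma g))%:E) T [tuple].
Hypothesis QtE : forall A, measurable A ->
  Qt A = arint qt h (fun g => (\1_A (reorder sigma g))%:E) T [tuple].
Hypothesis Qs1 : Qs setT = 1.
Hypothesis Qt1 : Qt setT = 1.

Let obs x (dd : T.-tuple R) : R * bool := psi x (tnth dd t).

Let measurable_obs x : measurable_fun setT (obs x).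
Proof. by have := measurableT_comp (measurable_psi x) (measurable_tnth t). Qed.

Let pushforward_probability x (Q : {measure set (T.-tuple R) -> \bar R}) :
  Q setT = 1 -> {P : probability (R * bool)%type R | P = pushforward Q (obs x) :> (set _ -> \bar R)}.
Proof.
move=> Q1; have P1 : measure_function_pushforward__canonical__measure_function_Measure Q
  (@measurable_obs x) setT = 1 by rewrite /= /pushforward preimage_setT.
by exists (probability_of P1).
Qed.

Lemma KL_obs_ge0 x : 0 <= KL (pushforward Qs (obs x)) (pushforward Qt (obs x)).
Proof.
have [Ps <-] := pushforward_probability x Qs1.
by have [Pt <-] := pushforward_probability x Qt1; exact: KL_ge0.
Qed.

(* At [x = B] the censoring is inactive: [min(D_t, B) = D_t] almost surely. *)
Lemma fenchel_obs (u : R -> R) (M a : R) :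
  Qs [set dd | B < tnth dd t]%R = 0 -> Qt [set dd | B < tnth dd t]%R = 0 ->
  measurable_fun setT u -> (forall y, 0 <= u y <= M)%R -> (0 <= a)%R ->
  \int[qs 0%N (h, [tuple])]_y (u y)%:E + 1 <=
  KL (pushforward Qs (obs B)) (pushforward Qt (obs B)) + a%:E +
  (expR (- a))%:E * \int[qt 0%N (h, [tuple])]_y (expR (u y))%:E.
Proof.
move=> Qs0 Qt0 mu u0M a0.
have mB : measurable [set dd : T.-tuple R | B < tnth dd t]%R.
  rewrite (_ : [set _ | _] = setT `&` (fun dd : T.-tuple R => tnth dd t) @^-1` `]B, +oo[%classic).
    by apply: measurable_tnth => //; exact: measurable_itv.
  by apply/seteqP; split => dd /=; rewrite in_itv/= andbT// => -[].
have mf : measurable_fun setT (fst : R * bool -> R) by exact: measurable_fst.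
(* A test function [v] of the demand lifts to [v o.1] on observations; off the null set where the
   demand exceeds [B], the first component of [obs B] is the demand. *)
have intE (q : forall s : nat, R.-pker (HT * s.-tuple R)%type ~> R)
    (Q : {measure set (T.-tuple R) -> \bar R}) (v : R -> R) :
    (forall A, measurable A ->
      Q A = arint q h (fun g => (\1_A (reorder sigma g))%:E) T [tuple]) ->
    Q setT = 1 -> Q [set dd | B < tnth dd t]%R = 0 ->
    measurable_fun setT v -> (forall y, 0 <= v y)%R ->
    \int[q 0%N (h, [tuple])]_y (v y)%:E = \int[pushforward Q (obs B)]_o (v o.1)%:E.
  move=> QE Q1 Q0 mv v0.
  have mve : measurable_fun setT (fun y => (v y)%:E) by exact/measurable_EFinP.
  rewrite -(integral_tnth_arint QE Q1 mve) => [|y]; last by rewrite lee_fin.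
  have mv1 : measurable_fun setT (fun o : R * bool => (v o.1)%:E).
    by have := measurableT_comp mve mf.
  have v10 (o : R * bool) : o \in [set: R * bool] -> 0 <= (v o.1)%:E by rewrite lee_fin.
  rewrite (ge0_integral_pushforward (@measurable_obs B) _ measurableT mv1 v10).
  rewrite preimage_setT; apply: ge0_ae_eq_integral => //.
  - by have := measurableT_comp mve (measurable_tnth t).
  - by have := measurableT_comp mv1 (@measurable_obs B).
  - by move=> dd _; rewrite lee_fin.
  - by move=> dd _; rewrite lee_fin.
  - exists [set dd | B < tnth dd t]%R; split => // dd /= /not_implyP[_].
    by rewrite ltNge; apply: contra_notN => DB; rewrite min_l.
rewrite (intE qs Qs)//; last by move=> y; have /andP[] := u0M y.
rewrite (intE qt Qt _ QtE Qt1 Qt0 (measurable_expR_comp mu) (fun=> expR_ge0 _)).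
have [Ps <-] := pushforward_probability B Qs1.
have [Pt <-] := pushforward_probability B Qt1.
apply: (@fenchel_KL _ _ _ Ps Pt (fun o => u o.1) M) => //.
by have := measurableT_comp mu mf.
Qed.

End one_round.
End observation.

(** * Assembly over the rounds *)

Unset Implicit Arguments.

Theorem theorem3p6 (R : realType) (T : nat) (B eta c_sc : R)
  (* true environment: law of the demands D_{1:T} *)
  (Pstar : probability (T.-tuple R) R)
  (* deployed policy pi_theta: law of X_t given H_{t-1} = h *)
  (pi : forall t : 'I_T, R.-pker (Hist R t) ~> R)
  (* induced interaction law P*_{pi_theta} of (D_{1:T}, X_{1:T}) *)
  (Pint : probability (T.-tuple R * T.-tuple R)%type R)
  (* true conditional laws Q*_t(.|h) and learned laws Q_{t,theta}(.|h) *)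
  (Qstar Qth : forall t : 'I_T, R.-pker (Hist R t) ~> T.-tuple R)
  (* autoregressive kernels q*_{t,s}, q_{t,s,theta} (s = prefix length) *)
  (qstar qth : forall (t : 'I_T) (s : nat),
      R.-pker (Hist R t * s.-tuple R)%type ~> R)
  (* common generation orders *)
  (sigma : forall t : 'I_T, {perm 'I_T}) :
  0 < B -> 0 < eta -> 0 < c_sc ->
  (* demands and actions lie in [0, B] *)
  Pstar [set dd | forall i, 0 <= tnth dd i <= B] = 1%E ->
  (forall t h, pi t h [set x | ~ (0 <= x <= B)] = 0%E) ->
  (forall t h, Qth t h [set dd | exists i, ~ (0 <= tnth dd i <= B)] = 0%E) ->
  (* Pint is the interaction law induced by Pstar and pi *)
  (forall C, measurable C -> Pint [set w | C w.1] = Pstar C) ->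
  (forall (t : 'I_T) (S : set (Hist R t * T.-tuple R)%type) (A : set R),
      measurable S -> measurable A ->
      Pint [set w | S (hist t w, w.1) /\ A (tnth w.2 t)] =
      (\int[Pint]_(w in [set w | S (hist t w, w.1)]) pi t (hist t w) A)%E) ->
  (* Q*_t(.|h) is the law of D_{1:T} given H_{t-1} = h *)
  (forall (t : 'I_T) (S : set (Hist R t)) (C : set (T.-tuple R)),
      measurable S -> measurable C ->
      Pint [set w | S (hist t w) /\ C w.1] =
      (\int[Pint]_(w in [set w | S (hist t w)]) Qstar t (hist t w) C)%E) ->
  (* common generation order, first generated coordinate = time t *)
  (forall (t : 'I_T) (j : 'I_T), nat_of_ord j = 0%N -> sigma t j = t) ->
  (* autoregressive factorizations *)
  (forall (t : 'I_T) (h : Hist R t) (A : set (T.-tuple R)), measurable A ->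
      Qstar t h A =
      arint (qstar t) h (fun g => (\1_A (reorder (sigma t) g))%:E) T [tuple]) ->
  (forall (t : 'I_T) (h : Hist R t) (A : set (T.-tuple R)), measurable A ->
      Qth t h A =
      arint (qth t) h (fun g => (\1_A (reorder (sigma t) g))%:E) T [tuple]) ->
  let dKL (t : 'I_T) (h : Hist R t) :=
      KL (qstar t 0%N (h, [tuple])) (qth t 0%N (h, [tuple])) in
  let delta (t : 'I_T) (s : nat) (h : Hist R t) :=
      (\int[Qstar t h]_dd
         KL (qstar t s (h, gen_prefix (sigma t) dd s))
            (qth t s (h, gen_prefix (sigma t) dd s)))%E in
  let Pobs (t : 'I_T) (h : Hist R t) (x : R) :=
      pushforward (Qstar t h) (fun dd => psi x (tnth dd t)) in
  let Qobs (t : 'I_T) (h : Hist R t) (x : R) :=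
      pushforward (Qth t h) (fun dd => psi x (tnth dd t)) in
  (* assumption (1): P(X_t = B | H_{t-1} = h) >= eta, for a.e. history *)
  (forall t : 'I_T, {ae Pint, forall w, (eta%:E <= pi t (hist t w) [set B])%E}) ->
  (* assumption (2): delta_s(h) <= (c_sc / s) d(h) for all s >= 2
     (paper's s = prefix length + 1), for a.e. history *)
  (forall t : 'I_T, {ae Pint, forall w, forall s : nat, (1 <= s < T)%N ->
      (delta t s (hist t w) <= (c_sc / s.+1%:R)%:E * dKL t (hist t w))%E}) ->
  let Delta_comp :=
      (\sum_(t < T) \int[Pint]_w KL (Qstar t (hist t w)) (Qth t (hist t w)))%E in
  let Delta_obs :=
      (\sum_(t < T) \int[Pint]_w
          KL (Pobs t (hist t w) (tnth w.2 t)) (Qobs t (hist t w) (tnth w.2 t)))%E in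
  (Delta_comp <= ((1 + c_sc * ln T%:R) / eta)%:E * Delta_obs)%E.
Proof.
move=> B0 eta0 c0 PstarB _ QthB PintD PintX PintQ sigma0 QsE QtE dKL delta Pobs Qobs
  etaP deltaP /=.
have Qs1 t h : Qstar t h setT = 1%E by exact: prob_kernel.
have Qt1 t h : Qth t h setT = 1%E by exact: prob_kernel.
have obs0 t h x : (0 <= KL (Pobs t h x) (Qobs t h x))%E.
  exact: (KL_obs_ge0 t (Qs1 t h) (Qt1 t h) x).
pose over (t : 'I_T) := [set dd : T.-tuple R | B < tnth dd t].
have over_meas (t : 'I_T) : measurable (over t).
  rewrite (_ : over t = setT `&` (fun dd : T.-tuple R => tnth dd t) @^-1` `]B, +oo[%classic).
    by apply: measurable_tnth => //; exact: measurable_itv.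
  by apply/seteqP; split => dd; rewrite /over /= in_itv/= andbT// => -[].
have in_meas : measurable [set dd : T.-tuple R | forall i, 0 <= tnth dd i <= B].
  rewrite (_ : [set _ | _] = \bigcap_(i in [set: 'I_T])
      (setT `&` (fun dd : T.-tuple R => tnth dd i) @^-1` `[0, B]%classic)).
    apply: fin_bigcap_measurable => // i _.
    by apply: measurable_tnth => //; exact: measurable_itv.
  apply/seteqP; split => dd /= dB i; first by split => //=; rewrite in_itv/=; exact: dB.
  by have [_] := dB i I; rewrite /= in_itv.
have out_over t : over t `<=`
    ~` [set dd : T.-tuple R | forall i, 0 <= tnth dd i <= B].
  by rewrite /over => dd /= Bdd /(_ t)/andP[_]; rewrite leNgt Bdd.
have Qt_over t h : Qth t h (over t) = 0%E.
  apply/eqP; rewrite eq_le measure_ge0 andbT -(QthB t h).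
  rewrite (_ : [set dd | exists i, ~ _] =
    ~` [set dd : T.-tuple R | forall i, 0 <= tnth dd i <= B]); last first.
    by apply/seteqP; split => dd /=; [move=> [i ni] /(_ i)|move=> /existsNP].
  apply: le_measure; [exact: (mem_set (over_meas t))|exact: (mem_set (measurableC in_meas))|
    exact: out_over].
have Pstar_over t : Pstar (over t) = 0%E.
  apply/eqP; rewrite eq_le measure_ge0 andbT.
  rewrite (@le_trans _ _ (Pstar (~` [set dd : T.-tuple R | forall i, 0 <= tnth dd i <= B])))//.
    apply: le_measure; [exact: (mem_set (over_meas t))|exact: (mem_set (measurableC in_meas))|
    exact: out_over].
  by rewrite probability_setC// PstarB subee.
(* [Pstar] gives no mass to demands above [B]; disintegrating over all histories, [Qstar] gives none
   at almost every history. *)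
have Qs_over (t : 'I_T) : {ae Pint, forall w, Qstar t (hist t w) (over t) = 0%E}.
  have mh := @measurable_hist R T t.
  have mq : measurable_fun setT (fun w => Qstar t (hist t w) (over t)).
    by have := measurableT_comp (measurable_kernel (Qstar t) _ (over_meas t)) mh.
  have := PintQ t setT _ measurableT (over_meas t).
  rewrite (_ : [set w : T.-tuple R * T.-tuple R | setT (hist t w) /\ _] = [set w : T.-tuple R * T.-tuple R | over t w.1]); last first.
    by apply/seteqP; split => w //= -[].
  rewrite PintD// Pstar_over (_ : [set w : T.-tuple R * T.-tuple R | setT (hist t w)] = setT)//.
  move=> /esym I0.
  have : (\int[Pint]_w `|Qstar t (hist t w) (over t)| = 0)%E.
    by rewrite -[RHS]I0; apply: eq_integral => w _; rewrite gee0_abs.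
  move=> /(ae_eq_integral_abs Pint measurableT mq).
  by apply: filterS => w /(_ I).
have dKL0 t h : (0 <= dKL t h)%E.
  exact: (KL_ge0 (probability_of (prob_kernel (s := qstar t 0%N) (h, [tuple])))
    (probability_of (prob_kernel (s := qth t 0%N) (h, [tuple])))).
pose kappa := 1 + c_sc * ln T%:R.
have kappa0 : 0 < kappa.
  rewrite ltr_pwDl// mulr_ge0 ?(ltW c0)//.
  (* For [T = 0] this is the convention [ln 0 = 0]. *)
  by case: (T) => [|n]; [rewrite ln0|rewrite ln_ge0// ler1n].
have compE (t : 'I_T) : {ae Pint, forall w,
    (KL (Qstar t (hist t w)) (Qth t (hist t w)) <= kappa%:E * dKL t (hist t w))%E}.
  apply: filterS (deltaP t) => w dP; set h := hist t w.
  have T0 : (0 < T)%N by exact: leq_trans (ltn_ord t).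
  have := fenchel_autoregressive (QsE t h) (QtE t h) (Qs1 t h).
  move=> /(@KL_le_fenchel _ _ _ (probability_of (Qs1 t h)) (probability_of (Qt1 t h))) KLle.
  apply: (le_trans KLle); rewrite big_ltn//.
  (* The empty prefix makes the first summand [d(h)]; a prefix of length [s] precedes the coordinate
     numbered [s + 1], hence [c_sc / s.+1]. *)
  have -> : (\int[Qstar t h]_x KL (qstar t 0%N (h, gen_prefix (sigma t) x 0))
      (qth t 0%N (h, gen_prefix (sigma t) x 0)) = dKL t h)%E.
    rewrite (_ : (fun x => _) = cst (dKL t h)); last first.
      by apply/funext => x; rewrite (tuple0 (gen_prefix (sigma t) x 0)).
    by rewrite integral_cst// Qs1 mule1.
  apply: (@le_trans _ _ (dKL t h + \sum_(1 <= s < T) (c_sc / s.+1%:R)%:E * dKL t h)%E).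
    apply: leeD2l; rewrite big_nat [leRHS]big_nat; apply: lee_sum => s sT.
    exact: dP.
  rewrite -ge0_sume_distrl => [|s _]; last by rewrite lee_fin divr_ge0// ltW.
  rewrite sumEFin -mulr_sumr /kappa EFinD ge0_muleDl ?lee_fin//; last first.
    by rewrite mulr_ge0 ?(ltW c0)// ln_ge0// ler1n.
  rewrite mul1e leeD2l// lee_wpmul2r// lee_fin ler_pM2l//.
  exact: sum_harmonic_le_ln.
have round (t : 'I_T) : (\int[Pint]_w KL (Qstar t (hist t w)) (Qth t (hist t w)) <=
    (kappa / eta)%:E * \int[Pint]_w
      KL (Pobs t (hist t w) (tnth w.2 t)) (Qobs t (hist t w) (tnth w.2 t)))%E.
  have [m [mm m0 mbound mle]] := countable_fenchelP (qstar t 0%N) (qth t 0%N).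
  pose M (h : Hist R t) := m (h, [tuple]).
  have mM : measurable_fun setT M.
    by have := measurableT_comp mm (measurable_pair2 [tuple]).
  have mh := @measurable_hist R T t.
  pose D := [set w : T.-tuple R * T.-tuple R | tnth w.2 t = B].
  have mD : measurable D.
    rewrite (_ : D = setT `&` (fun w : T.-tuple R * T.-tuple R => tnth w.2 t) @^-1` [set B]).
      by apply: (measurableT_comp (measurable_tnth t) measurable_snd) => //; exact: measurable_set1.
    by apply/seteqP; split => w //= -[].
  have dM h : (dKL t h <= M h)%E.
    exact: (@KL_le_fenchel _ _ _ (probability_of (prob_kernel (s := qstar t 0%N) (h, [tuple])))
      (probability_of (prob_kernel (s := qth t 0%N) (h, [tuple]))) _ (mbound _)).
  have Mobs : {ae Pint, forall w, (M (hist t w) <= KL (Pobs t (hist t w) B) (Qobs t (hist t w) B))%E}.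
    apply: filterS (Qs_over t) => w Q0; apply: mle => c n.
    have [mc [K cK]] := step_funP R c.
    exact: (fenchel_obs (sigma0 t) (QsE t _) (QtE t _) (Qs1 t _) (Qt1 t _) Q0 (Qt_over t _) mc cK (ler0n _ _)).
  (* Assumption (1) integrated over the histories in [S]; [PintX] with action set [[set B]] turns
     the integral of [pi] into a joint probability. *)
  have etaD S : measurable S ->
      (eta%:E * Pint (hist t @^-1` S) <= Pint (hist t @^-1` S `&` D))%E.
    move=> mS.
    have mhS : measurable (hist t @^-1` S) by rewrite -[X in measurable X]setTI; exact: mh.
    have := PintX t (S `*` setT) [set B] (measurableX mS measurableT) (measurable_set1 B).
    rewrite (_ : [set w : T.-tuple R * T.-tuple R | (S `*` setT) (hist t w, w.1) /\ _] = hist t @^-1` S `&` D); last first.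
      by apply/seteqP; split => w /=; [move=> [[]]|move=> []].
    rewrite (_ : [set w : T.-tuple R * T.-tuple R | (S `*` setT) (hist t w, w.1)] = hist t @^-1` S); last first.
      by apply/seteqP; split => w /=; [move=> []|].
    move=> ->; rewrite -integral_cst//.
    apply: ae_ge0_le_integral => //.
    - by move=> w _; rewrite lee_fin ltW.
    - apply: measurable_funTS.
      by have := measurableT_comp (measurable_kernel (pi t) _ (measurable_set1 B)) mh.
    - by apply: filterS (etaP t) => w.
  have := ge0_le_integral_conditional (eta := NngNum (ltW eta0)) mh mD etaD mM (fun=> m0 _).
  move=> /= etaM.
  apply: (@le_trans _ _ (kappa%:E * \int[Pint]_w M (hist t w))%E).
    apply: (@le_trans _ _ (\int[Pint]_w (kappa%:E * M (hist t w)))%E).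
      apply: ae_ge0_le_integral_lower.
      - move=> w; exact: (KL_ge0 (probability_of (Qs1 t _)) (probability_of (Qt1 t _))).
      - by move=> w; rewrite mule_ge0 ?lee_fin ?(ltW kappa0)//; exact: m0.
      - apply: filterS (compE t) => w /le_trans; apply.
        by rewrite lee_pmul2l// ?lte_fin//; exact: dM.
    by apply: ge0_integralZl_lower => // w; exact: m0.
  rewrite EFinM -muleA lee_pmul2l ?lte_fin// lee_pdivlMl//.
  apply: (le_trans etaM); apply: ae_ge0_le_integral_lower.
  - by move=> w; rewrite mule_ge0// ?lee_fin//; exact: m0.
  - by move=> w; exact: obs0.
  (* On [D] the action is [B] and [Mobs] applies; off [D] the left side is 0. *)
  - apply: filterS Mobs => w Mo; rewrite indicE.
    have [wD|wD] := boolP (w \in D); last by rewrite mule0; exact: obs0.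
    by have wB : tnth w.2 t = B := set_mem wD; rewrite mule1 wB.
rewrite ge0_sume_distrr => [|t _]; last by apply: integral_ge0 => w _; exact: obs0.
by apply: lee_sum => t _; exact: round.
Qed.
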